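(* For every finite graph $\Gamma$ without loops and bigons, there is an injective group homomorphism $G_\Gamma\to Ham(S^2)$ from the right-angled Artin group $G_\Gamma$ to the group of Hamiltonian symplectomorphisms of the 2-sphere. Moreover, the homomorphism can be chosen so that the image of $G_\Gamma$ fixes pointwise a closed disk (with nonempty interior) in $S^2$.
   Context: For a graph $\Gamma$ with vertex set $V(\Gamma)$ and edge set $E(\Gamma)$, having no loops and no bigons (i.e. a simplicial complex of dimension $\le 1$), the right-angled Artin group is $G_\Gamma=\langle g_v,\ v\in V(\Gamma)\mid [g_v,g_w]=1 \text{ whenever } [vw]\notin E(\Gamma)\rangle$. (Generators commute when the vertices are NOT joined by an edge; this is opposite to the usual convention.) For a symplectic manifold $(M,\omega)$ and a smooth function $H:M\times\mathbb R\to\mathbb R$, the time-dependent Hamiltonian vector field $X_H$ is defined by $\omega(X_H,\xi)=dH(\xi)$ for all $\xi\in TM$; Hamiltonian symplectomorphisms are the maps $f_t=F(\cdot,t)$, where $F(x,0)=x$ and $\partial_t F(x,t)=X_H(F(x,t),t)$. For closed $M$ they form a group $Ham(M,\omega)$. For a closed oriented surface the area form is unique up to diffeomorphism and scaling (Moser), so one writes $Ham(M)$. *)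

(* Defs.v *)
From HB Require Import structures.
From mathcomp Require Import all_boot all_order all_algebra generic_quotient.
From mathcomp Require Import all_classical all_reals all_analysis.
Set Implicit Arguments.
Unset Strict Implicit.
Unset Printing Implicit Defensive.
Import Order.TTheory GRing.Theory Num.Theory.
Import numFieldNormedType.Exports.
Local Open Scope classical_set_scope.
Local Open Scope ring_scope.

Section RAAG.
Variables (V : finType) (e : rel V).

(* The letter (v, b) stands for g_v if b is true and for g_v^-1 otherwise. *)
Local Notation raag_word := (seq (V * bool)).

(* Generators commute when their vertices are NOT joined by an edge (the
   opposite of the usual convention); the commutator is g_v^-1 g_w^-1 g_v g_w,
   as in MathComp. *)
Inductive raag_eqv : raag_word -> raag_word -> Prop :=
| raag_eqv_refl s : raag_eqv s s
| raag_eqv_sym s t : raag_eqv s t -> raag_eqv t s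
| raag_eqv_trans t s u : raag_eqv s t -> raag_eqv t u -> raag_eqv s u
| raag_eqv_cat s s' t t' :
    raag_eqv s s' -> raag_eqv t t' -> raag_eqv (s ++ t) (s' ++ t')
| raag_eqv_cancel v b : raag_eqv [:: (v, b); (v, ~~ b)] [::]
| raag_eqv_comm v w : ~~ e v w ->
    raag_eqv [:: (v, false); (w, false); (v, true); (w, true)] [::].

Definition raag_rel : rel raag_word := fun s t => `[< raag_eqv s t >].

Fact raag_rel_refl : reflexive raag_rel.
Proof. by move=> s; apply/asboolP; constructor. Qed.

Fact raag_rel_sym : symmetric raag_rel.
Proof. by move=> s t; apply/asboolP/asboolP => ?; apply: raag_eqv_sym. Qed.

Fact raag_rel_trans : transitive raag_rel.
Proof.
move=> t s u /asboolP st /asboolP tu; apply/asboolP; exact: raag_eqv_trans tu.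
Qed.

Canonical raag_equiv_rel :=
  EquivRel raag_rel raag_rel_refl raag_rel_sym raag_rel_trans.

Definition raag : Type := {eq_quot raag_equiv_rel}%qT.
HB.instance Definition _ := Choice.on raag.
HB.instance Definition _ := EqQuotient.on raag.

Definition raag_of_word (s : raag_word) : raag := (\pi_raag s)%qT.

Definition raag_mul (x y : raag) : raag := raag_of_word (repr x ++ repr y).

Definition inv_word (s : raag_word) : raag_word :=
  rev [seq (p.1, ~~ p.2) | p <- s].

Definition raag_inv (x : raag) : raag := raag_of_word (inv_word (repr x)).

Fact raag_of_wordP s t : raag_of_word s = raag_of_word t <-> raag_eqv s t.
Proof.
rewrite /raag_of_word; split=> [/eqmodP/asboolP //|st].
by apply/eqmodP/asboolP.
Qed.

Fact raag_of_wordK x : raag_of_word (repr x) = x.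
Proof. exact: reprK. Qed.

Fact repr_raag_of_word s : raag_eqv (repr (raag_of_word s)) s.
Proof. by apply/raag_of_wordP; rewrite raag_of_wordK. Qed.

Fact raag_mulE s t :
  raag_mul (raag_of_word s) (raag_of_word t) = raag_of_word (s ++ t).
Proof. by apply/raag_of_wordP/raag_eqv_cat; exact: repr_raag_of_word. Qed.

Fact cat_inv_word s : raag_eqv (s ++ inv_word s) [::].
Proof.
elim: s => [|[v b] s IHs]; first exact: raag_eqv_refl.
have -> : ((v, b) :: s) ++ inv_word ((v, b) :: s) =
    [:: (v, b)] ++ ((s ++ inv_word s) ++ [:: (v, ~~ b)]).
  by rewrite /inv_word map_cons rev_cons -cats1 -catA.
apply: raag_eqv_trans (raag_eqv_cancel v b).
apply: (@raag_eqv_cat [:: _] [:: _]); first exact: raag_eqv_refl.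
by apply: (@raag_eqv_cat _ [::]) => //; exact: raag_eqv_refl.
Qed.

Fact inv_wordK : involutive inv_word.
Proof.
move=> s; rewrite /inv_word map_rev revK -map_comp -[RHS]map_id.
by apply: eq_map => -[v b] /=; rewrite negbK.
Qed.

Fact raag_mulA : associative raag_mul.
Proof.
move=> x y z; rewrite -[x]raag_of_wordK -[y]raag_of_wordK -[z]raag_of_wordK.
by rewrite !raag_mulE catA.
Qed.

Fact raag_mul1 : left_id (raag_of_word [::]) raag_mul.
Proof. by move=> x; rewrite -[x]raag_of_wordK raag_mulE. Qed.

Fact raag_mulr1 : right_id (raag_of_word [::]) raag_mul.
Proof. by move=> x; rewrite -[x]raag_of_wordK raag_mulE cats0. Qed.

Fact raag_mulV : right_inverse (raag_of_word [::]) raag_inv raag_mul.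
Proof.
move=> x; rewrite -[x in raag_mul x]raag_of_wordK /raag_inv raag_mulE.
by apply/raag_of_wordP; exact: cat_inv_word.
Qed.

Fact raag_mulVl : left_inverse (raag_of_word [::]) raag_inv raag_mul.
Proof.
move=> x; rewrite -[x in raag_mul _ x]raag_of_wordK /raag_inv raag_mulE.
apply/raag_of_wordP.
by rewrite -{2}[repr x]inv_wordK; exact: cat_inv_word.
Qed.

HB.instance Definition _ := isGroup.Build raag
  raag_mulA raag_mul1 raag_mulr1 raag_mulVl raag_mulV.

End RAAG.

Section Smooth.
Variables (R : realType) (V : normedModType R).

(* V is meant to be finite-dimensional. *)
Fixpoint Ck (k : nat) (U : set V) (f : V -> R) : Prop :=
  if k is k'.+1 then
    (forall x, U x -> differentiable f x) /\ (forall v, Ck k' U ('D_v f))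
  else forall x, U x -> {for x, continuous f}.

Definition smooth (U : set V) (f : V -> R) : Prop := forall k, Ck k U f.

End Smooth.

Section Sphere.
Variable R : realType.

Definition dot (n : nat) (u v : 'rV[R]_n) : R := \sum_(i < n) u 0 i * v 0 i.

Definition S2 : Type := set_type [set x : 'rV[R]_3 | dot x x = 1].
HB.instance Definition _ := Topological.on S2.

Definition tangent (x : S2) (xi : 'rV[R]_3) : Prop := dot (val x) xi = 0.

(* The standard area form: omega_x(u, v) = det(x, u, v). *)
Definition area_form (x : S2) (u v : 'rV[R]_3) : R :=
  \det (\matrix_(i < 3) [:: val x; u; v]`_i).

(* S^2 x R is an embedded submanifold of R^3 x R, so smoothness is the local
   existence of smooth extensions. *)
Definition smooth_S2R (H : S2 -> R -> R) : Prop :=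
  forall (x : S2) (t : R),
    exists (U : set ('rV[R]_3 * R)) (h : 'rV[R]_3 * R -> R),
      [/\ open_nbhs (val x, t) U, smooth U h
        & forall (y : S2) (s : R), U (val y, s) -> h (val y, s) = H y s].

(* dh_x(xi) = l, computed along curves in S^2 through x with velocity xi. *)
Definition is_dS2 (h : S2 -> R) (x : S2) (xi : 'rV[R]_3) (l : R) : Prop :=
  forall c : R -> S2, c 0 = x ->
    is_derive (0 : R) (1 : R) (fun s => val (c s)) xi ->
    is_derive (0 : R) (1 : R) (fun s => h (c s)) l.

Definition ham_vector_field (H : S2 -> R -> R) (X : S2 -> R -> 'rV[R]_3) :
    Prop :=
  forall (x : S2) (t : R), tangent x (X x t) /\
    forall xi, tangent x xi -> is_dS2 (H ^~ t) x xi (area_form x (X x t) xi).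

Definition is_flow (X : S2 -> R -> 'rV[R]_3) (F : S2 -> R -> S2) : Prop :=
  (forall x, F x 0 = x) /\
  (forall x (t : R), is_derive t (1 : R) (fun s => val (F x s)) (X (F x t) t)).

(* The flow F is not required to be smooth: as the solution of an ODE with
   smooth right-hand side it is automatically. *)
Definition Ham : set (S2 -> S2) :=
  [set f | exists H X F, [/\ smooth_S2R H, ham_vector_field H X,
                             is_flow X F & exists t, f = F ^~ t]].

Definition homeomorphic (X Y : topologicalType) : Prop :=
  exists (f : X -> Y) (g : Y -> X),
    [/\ continuous f, continuous g, cancel f g & cancel g f].

Definition unit_disk : set 'rV[R]_2 := [set x | dot x x <= 1].

Definition closed_disk (D : set S2) : Prop :=
  homeomorphic (set_type unit_disk) (set_type D).

End Sphere.

(* Main.v *)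
Require Import Defs.
From HB Require Import structures.
From mathcomp Require Import all_boot all_order all_algebra.
From mathcomp Require Import all_classical all_reals all_analysis.
From mathcomp Require Import ring lra.

(** Why the theorem is true.

    A function f(<x, n>) of the height over a unit axis n generates on the
    sphere the flow that rotates the circle of height z about n with angular
    speed f'(z). If f is constant off a small interval, this flow is supported
    in a thin annulus around a round circle, where it is a strong twist, and
    everything about it is explicit: [is_derive_flow], [ham_gradient].

    Round circles are indexed by the finite sequences of vertices without
    repetition, possibly among others. The parent of a nonempty sequence is its
    tail. The circle of y :: s is a tiny circle around a point of the circle of
    s, so that two circles cross if one is the parent of the other and are
    disjoint otherwise; this is possible for every graph, planar or not, because
    sequences form a tree: [config_exists]. The same holds for thin annuli
    around the circles: [thick_exists]. The generator of v acts by the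
    simultaneous twist of all annuli whose index is a path of the graph, listed
    backwards, that ends at v. If v and w are not joined by an edge then no
    annulus for v meets an annulus for w, and the two twists commute:
    [flow_comm]. So the group acts on the sphere.

    The action is faithful by a ping-pong argument played with curves instead
    of points. A curve that crosses the annulus of s inside the annulus of a
    neighbour of s is wound by any nonzero power of the twist all around the
    annulus of s, hence crosses afterwards, inside the annulus of s, the annuli
    of all neighbours of s: [twist_crosses]. Write a nontrivial element as a
    word with the least number of syllables, and let x be one of its letters.
    Between two syllables of x there is a letter y joined to x, for otherwise
    they could be merged: [minimal_between]. The subword between them is shorter
    and, by induction, takes the curve back to one that crosses the annulus of
    x :: anc inside that of y :: x :: anc, ready for the next power of x:
    [pingpong]. The letters already met along a branch no longer occur in the
    subword, whence finitely many circles are enough although the graph may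
    have cycles. The induction starts with the circle of the empty sequence,
    about which nothing twists: it crosses the annulus of x but not its own
    annulus, whereas its image under the word crosses the latter: [phi_faithful].

    The image of a word is Hamiltonian since the flows of its letters can be
    performed one after the other, each along a smooth step in time:
    [ham_path_flow]. All annuli avoid a neighbourhood of the north pole, so a
    polar cap is fixed: [phi_fixes_cap]. *)

Set Implicit Arguments.
Unset Strict Implicit.
Unset Printing Implicit Defensive.
Import Order.TTheory GRing.Theory Num.Theory.
Import numFieldNormedType.Exports.
Local Open Scope classical_set_scope.
Local Open Scope ring_scope.

(** * Vectors and rotations of the three-dimensional space *)

Section VectorAlgebra.
Variable R : realType.
Local Notation E := 'rV[R]_3.
Implicit Types (u v w x n : E) (a b t : R).

Definition vec3 a b c : E := \row_(i < 3) [:: a; b; c]`_i.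

Definition cross u v : E :=
  vec3 (u 0 1 * v 0 2%:R - u 0 2%:R * v 0 1)
       (u 0 2%:R * v 0 0 - u 0 0 * v 0 2%:R)
       (u 0 0 * v 0 1 - u 0 1 * v 0 0).

Lemma dot3E u v :
  dot u v = u 0 0 * v 0 0 + u 0 1 * v 0 1 + u 0 2%:R * v 0 2%:R.
Proof.
rewrite /dot !big_ord_recr big_ord0 /= add0r.
by congr (_ + _ + _); congr (u _ _ * v _ _); apply/val_inj.
Qed.

Lemma vec3E a b c :
  (vec3 a b c 0 0 = a) * (vec3 a b c 0 1 = b) * (vec3 a b c 0 2%:R = c).
Proof. by rewrite /vec3 !mxE. Qed.

Lemma crossE u v :
  (cross u v 0 0 = u 0 1 * v 0 2%:R - u 0 2%:R * v 0 1) *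
  (cross u v 0 1 = u 0 2%:R * v 0 0 - u 0 0 * v 0 2%:R) *
  (cross u v 0 2%:R = u 0 0 * v 0 1 - u 0 1 * v 0 0).
Proof. by rewrite /cross !vec3E. Qed.

Let coordE := (crossE, vec3E, mxE, dot3E).

Lemma dotC u v : dot u v = dot v u.
Proof. by rewrite !dot3E; ring. Qed.

Lemma dotDl u v w : dot (u + v) w = dot u w + dot v w.
Proof. by rewrite !dot3E !mxE; ring. Qed.

Lemma dotZl a u w : dot (a *: u) w = a * dot u w.
Proof. by rewrite !dot3E !mxE; ring. Qed.

Lemma dotNl u w : dot (- u) w = - dot u w.
Proof. by rewrite !dot3E !mxE; ring. Qed.

Lemma dotDr u v w : dot w (u + v) = dot w u + dot w v.
Proof. by rewrite dotC dotDl !(dotC w). Qed.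

Lemma dotZr a u w : dot w (a *: u) = a * dot w u.
Proof. by rewrite dotC dotZl (dotC w). Qed.

Lemma dotNr u w : dot w (- u) = - dot w u.
Proof. by rewrite dotC dotNl (dotC w). Qed.

Definition dotE := (dotDl, dotDr, dotZl, dotZr, dotNl, dotNr).

Lemma dot_ge0 u : 0 <= dot u u.
Proof. by rewrite dot3E !addr_ge0 // -expr2 sqr_ge0. Qed.

Lemma rV3P u v :
  u 0 0 = v 0 0 -> u 0 1 = v 0 1 -> u 0 2%:R = v 0 2%:R -> u = v.
Proof.
move=> h0 h1 h2; apply/rowP => -[[|[|[|//]]] h].
- by have -> : Ordinal h = 0 by apply/val_inj.
- by have -> : Ordinal h = 1 by apply/val_inj.
- by have -> : Ordinal h = 2%:R by apply/val_inj.
Qed.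

Lemma dot_eq0 u : dot u u = 0 -> u = 0.
Proof.
rewrite dot3E => h.
have [h0 h1 h2] : [/\ u 0 0 * u 0 0 = 0, u 0 1 * u 0 1 = 0
    & u 0 2%:R * u 0 2%:R = 0].
  have := (sqr_ge0 (u 0 0), sqr_ge0 (u 0 1), sqr_ge0 (u 0 2%:R)).
  by rewrite !expr2 => -[[]] *; split; lra.
by apply: rV3P; rewrite mxE; apply/eqP; rewrite -[_ == _]orbb -mulf_eq0;
   apply/eqP.
Qed.

Lemma dot_cross u v w : dot (cross u v) w = dot v (cross w u).
Proof. by rewrite !coordE; ring. Qed.

Lemma dot_crossv u v : dot (cross u v) v = 0.
Proof. by rewrite !coordE; ring. Qed.

Lemma dot_crossu u v : dot (cross u v) u = 0.
Proof. by rewrite !coordE; ring. Qed.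

Lemma dot_cross_cross w x u v : dot (cross w x) (cross u v) =
  dot w u * dot x v - dot w v * dot x u.
Proof. by rewrite !coordE; ring. Qed.

(** The source of the decomposition of vectors in an orthonormal frame, and of
    the Cauchy-Schwarz inequality because the left-hand side is a square. *)
Lemma lagrange_identity u v :
  dot (cross u v) (cross u v) = dot u u * dot v v - dot u v ^+ 2.
Proof. by rewrite !coordE; ring. Qed.

Lemma cauchy_schwarz u v : dot u v ^+ 2 <= dot u u * dot v v.
Proof. by rewrite -subr_ge0 -lagrange_identity dot_ge0. Qed.

Lemma cross_cross n x : cross n (cross n x) = dot n x *: n - dot n n *: x.
Proof. by apply: rV3P; rewrite !coordE; ring. Qed.

Lemma crossDr n x y : cross n (x + y) = cross n x + cross n y.
Proof. by apply: rV3P; rewrite !coordE; ring. Qed.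

Lemma crossZr n a x : cross n (a *: x) = a *: cross n x.
Proof. by apply: rV3P; rewrite !coordE; ring. Qed.

Lemma crossvv n : cross n n = 0.
Proof. by apply: rV3P; rewrite !coordE; ring. Qed.

Lemma dot_crossC u v w : dot u (cross v w) = - dot u (cross w v).
Proof. by rewrite !coordE; ring. Qed.

(** The family n, e, n x e is an orthonormal frame of the space. Completeness
    comes from expanding |n x y|^2 |e|^2 by the Lagrange identity, which gives
    |y|^2 as the sum of the squares of the three coordinates; it is then
    applied to the difference of the two sides. *)
Lemma frame_decomp n e x : dot n n = 1 -> dot e e = 1 -> dot e n = 0 ->
  x = dot x n *: n + dot x e *: e + dot x (cross n e) *: cross n e.
Proof.
move=> nn ee en.
have key (y : E) : dot y y = dot y n ^+ 2 + dot y e ^+ 2 + dot y (cross n e) ^+ 2.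
  have : dot (cross n y) (cross n y) * dot e e = dot (cross n y) e ^+ 2 +
     dot (cross (cross n y) e) (cross (cross n y) e).
    by rewrite (lagrange_identity (cross n y) e); ring.
  have -> : cross (cross n y) e = dot n e *: y - dot y e *: n.
    by apply: rV3P; rewrite !coordE; ring.
  rewrite lagrange_identity ee nn dot_cross dot_crossC !dotE nn (dotC n e) en (dotC n y).
  by move=> h; nra.
apply/subr0_eq/dot_eq0; rewrite key !dotE.
have cn := lagrange_identity n e.
rewrite nn ee (dotC n e) en in cn.
rewrite ?nn ?ee ?(dotC n e) ?en ?cn ?dot_crossu ?dot_crossv.
rewrite (dotC n (cross n e)) (dotC e (cross n e)) ?dot_crossu ?dot_crossv.
ring.
Qed.

Lemma frame_norm n e x : dot n n = 1 -> dot e e = 1 -> dot e n = 0 ->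
  dot x x = dot x n ^+ 2 + dot x e ^+ 2 + dot x (cross n e) ^+ 2.
Proof.
move=> nn ee en; rewrite {1 2}(frame_decomp x nn ee en) !dotE.
have cn := lagrange_identity n e.
rewrite nn ee (dotC n e) en in cn.
rewrite ?nn ?ee ?(dotC n e) ?en ?cn ?dot_crossu ?dot_crossv.
rewrite (dotC n (cross n e)) (dotC e (cross n e)) ?dot_crossu ?dot_crossv.
ring.
Qed.

(** Rodrigues' formula for the rotation of angle t about the unit axis n. It is
    linear in cos t and sin t, so that derivatives in t and continuity in x are
    read off directly. *)
Definition rotation n t x : E :=
  (cos t) *: x + sin t *: cross n x + ((1 - cos t) * dot n x) *: n.

Lemma rotation0 n x : rotation n 0 x = x.
Proof. by rewrite /rotation cos0 sin0 subrr mul0r !scale0r scale1r !addr0. Qed.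

Section Rot.
Variables (n : E).
Hypothesis nn : dot n n = 1.

Lemma dot_rotation_axis t x : dot (rotation n t x) n = dot x n.
Proof. by rewrite !dotE dot_crossu nn (dotC n x); ring. Qed.

Lemma rotationD s t x : rotation n (s + t) x = rotation n s (rotation n t x).
Proof.
rewrite {2}/rotation (dotC n) dot_rotation_axis {1 2}/rotation.
rewrite !crossDr !crossZr crossvv cross_cross nn cosD sinD (dotC x).
apply: rV3P; rewrite !coordE; ring.
Qed.

(** The right-hand side is the derivative of the rotation in its angle:
    rotating is the flow of the field x |-> n x x. *)
Lemma cross_rotation t x : cross n (rotation n t x) =
  - sin t *: x + cos t *: cross n x + (sin t * dot n x) *: n.
Proof.
rewrite !crossDr !crossZr crossvv cross_cross nn.
by apply: rV3P; rewrite !coordE; ring.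
Qed.

Lemma dot_rotation t x : dot (rotation n t x) (rotation n t x) = dot x x.
Proof.

rewrite !dotE lagrange_identity nn (dotC x (cross n x)) dot_crossv dot_crossu.
rewrite (dotC n (cross n x)) dot_crossu (dotC x n).
ring: (sin2cos2 t).
Qed.

(** In the frame e, n x e the rotation acts on the two coordinates by the
    usual addition formulas; this is what turns the twist into an addition of
    angles. *)
Lemma dot_rotation_frame e t x : dot e n = 0 ->
  dot (rotation n t x) e = cos t * dot x e - sin t * dot x (cross n e).
Proof.
move=> en; rewrite !dotE dot_cross (dotC n e) en dot_crossC; ring.
Qed.

Lemma dot_rotation_frame' e t x : dot e n = 0 ->
  dot (rotation n t x) (cross n e) = cos t * dot x (cross n e) + sin t * dot x e.
Proof.
move=> en; rewrite !dotE (dotC n (cross n e)) dot_crossu.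
have -> : dot (cross n x) (cross n e) = dot x e.
  by rewrite dot_cross_cross nn (dotC n e) en; ring.
ring.
Qed.

End Rot.
End VectorAlgebra.

(** * A smooth step function *)

Section SmoothStep.
Variable R : realType.
Implicit Types (f g : R -> R) (k n : nat) (x t : R).

(** Existence of k derivatives on the whole line. The derivative is
    existentially quantified, which makes the induction for products
    immediate. *)
Fixpoint Dk k f : Prop :=
  if k is k'.+1 then
    exists f', (forall x, is_derive x (1 : R) f (f' x)) /\ Dk k' f'
  else True.

Lemma DkW k f : Dk k.+1 f -> Dk k f.
Proof.
elim: k f => [//|k IH] f [f' [df' Df']].
by exists f'; split => //; exact: IH.
Qed.

Lemma Dk_cst k (c : R) : Dk k (cst c).
Proof.
elim: k c => [//|k IH] c; exists (cst 0); split => [x|]; last exact: IH.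
exact: is_derive_cst.
Qed.

Lemma DkD k f g : Dk k f -> Dk k g -> Dk k (f + g).
Proof.
elim: k f g => [//|k IH] f g [f' [df Df]] [g' [dg Dg]].
by exists (f' + g'); split => [x|]; [exact: is_deriveD|exact: IH].
Qed.

Lemma DkM k f g : Dk k f -> Dk k g -> Dk k (f * g).
Proof.
elim: k f g => [//|k IH] f g [f' [df Df]] [g' [dg Dg]].
exists (f' * g + f * g'); split => [x|]; last first.
  by apply: DkD; apply: IH => //; apply: DkW; [exists g'|exists f'].
apply: is_derive_eq; rewrite /GRing.scale/=.
by rewrite addrC !fctE mulrC.
Qed.

Lemma DkV k f : (forall x, f x != 0) -> Dk k f -> Dk k (fun x => (f x)^-1).
Proof.
move=> f0; elim: k => [//|k IH] [f' [df Df]].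
exists (fun x => - ((f x)^-1 * (f x)^-1) * f' x); split => [x|].
  apply: is_derive_eq (is_deriveV _ _) _ => //.
  by rewrite /GRing.scale/= -exprVn expr2.
have D := IH (DkW (ex_intro _ f' (conj df Df))).
have -> : (fun x => - ((f x)^-1 * (f x)^-1) * f' x) =
  cst (-1) * ((fun x => (f x)^-1) * (fun x => (f x)^-1) * f').
  by apply/funext => x; rewrite !fctE mulN1r mulNr.
by apply: DkM; [exact: Dk_cst|do 2?apply: DkM].
Qed.

Lemma is_derive_affine f (f' a b x : R) : is_derive (a * x + b) (1 : R) f f' ->
  is_derive x (1 : R) (fun x => f (a * x + b)) (a * f').
Proof.
move=> df; have da : is_derive x (1 : R) (fun x => a * x + b) a.
  have -> : (fun x => a * x + b) = a *: id + cst b :> (R -> R) by [].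
  by apply: is_derive_eq; rewrite addr0 /GRing.scale /= mulr1.
rewrite mulrC.
exact: (@is_derive1_comp _ f (fun x => a * x + b) x _ _ df da).
Qed.

Lemma Dk_affine k f (a b : R) : Dk k f -> Dk k (fun x => f (a * x + b)).
Proof.
elim: k f => [//|k IH] f [f' [df Df]].
exists (cst a * (fun x => f' (a * x + b))); split => [x|]; last first.
  by apply: DkM; [exact: Dk_cst|exact: IH].
exact: is_derive_affine.
Qed.

(** The functions x^-n exp(-1/x), extended by zero to x <= 0. The family is
    closed under derivation, which proves the smoothness of exp(-1/x) without a
    formula for its iterated derivatives. *)
Definition flat n x : R :=
  if 0 < x then x^-1 ^+ n * expR (- x^-1) else 0.

(** One term of the exponential series, exp y >= y^(n+2)/(n+2)! with y = 1/x,
    is enough: the resulting quadratic bound gives both the continuity and the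
    vanishing derivative at 0. *)
Lemma flat_bound n x : `|flat n x| <= n.+2`!%:R * x ^+ 2.
Proof.
rewrite /flat; case: ifPn => x0; last first.
  by rewrite normr0 mulr_ge0 // sqr_ge0.
have xV : 0 < x^-1 by rewrite invr_gt0.
rewrite ger0_norm; last by rewrite mulr_ge0 ?expR_ge0 // exprn_ge0 // ltW.
rewrite expRN ler_pdivrMr ?expR_gt0 //.
have -> : x ^+ 2 = (x^-1 ^+ 2)^-1 by rewrite exprVn invrK.
rewrite -mulrA -ler_pdivrMl ?ltr0n ?fact_gt0 // ler_pdivlMl ?exprn_gt0 //.
rewrite mulrCA -exprD add2n mulrC.
by apply: le_trans (expR_ge1Dxn n.+1 (ltW xV)); rewrite lerDr.
Qed.

Lemma is_derive_flat0 n : is_derive (0 : R) (1 : R) (flat n) 0.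
Proof.
have H : h^-1 *: (flat n (h *: 1 + 0) - flat n 0) @[h --> (0 : R)^'] --> (0 : R).
  apply/cvgrPdist_le => /= e e0; near=> h.
  have h0 : h != 0 by near: h; exact: nbhs_dnbhs_neq.
  rewrite sub0r normrN /flat ltxx subr0 addr0 -/(flat n _).
  rewrite [h *: _]mulr1 /GRing.scale/= normrM normfV.
  rewrite mulrC ler_pdivrMr ?normr_gt0 //.
  apply: le_trans (flat_bound _ _) _.
  rewrite -[h ^+ 2]real_normK ?num_real // expr2 mulrA ler_pM2r ?normr_gt0 //.
  rewrite mulrC -ler_pdivlMr ?ltr0n ?fact_gt0 //.
  near: h; apply: dnbhs0_le.
  by rewrite divr_gt0 // ltr0n fact_gt0.
by apply: DeriveDef; [apply/cvg_ex; exists 0|apply/cvg_lim].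
Unshelve. all: by end_near. Qed.

Lemma is_derive_flat n x :
  is_derive x (1 : R) (flat n) (flat n.+2 x - n%:R * flat n.+1 x).
Proof.
have [x0|x0|->] := ltgtP x 0.
- have -> : flat n.+2 x - n%:R * flat n.+1 x = 0.
    by rewrite /flat ltNge (ltW x0) /= mulr0 subr0.
  apply: near_eq_is_derive (is_derive_cst 0 _ _).
  near=> y; rewrite /flat ltNge ltW //=.
  by near: y; exact: lt_nbhsl.
- have xn : x != 0 by rewrite gt_eqF.
  apply: (@near_eq_is_derive R R^o R^o (fun y : R => y^-1 ^+ n * expR (- y^-1))).
    near=> y; rewrite /flat ifT //.
    by near: y; exact: lt_nbhsr.
  rewrite /flat x0.
  have dV : is_derive x (1 : R) (fun y => y^-1) (- x ^- 2).
    by apply: is_derive_eq (is_deriveV _ _) _ => //; rewrite /GRing.scale/= mulr1.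
  have dX : is_derive x (1 : R) (fun y => y^-1 ^+ n)
      (n%:R * x^-1 ^+ n.-1 * - x ^- 2).
    have -> : (fun y : R => y^-1 ^+ n) = (fun y : R => y^-1) ^+ n.
      by apply/funext => y; rewrite fctE.
    apply: (is_derive_eq (@is_deriveX _ _ _ n _ _ _ dV)).
    by rewrite /GRing.scale/= mulr_natl.
  have dE : is_derive x (1 : R) (fun y => expR (- y^-1))
      (expR (- x^-1) * x ^- 2).
    have dN : is_derive x (1 : R) (fun y => - y^-1) (x ^- 2).
      by apply: is_derive_eq; rewrite opprK.
    exact: (@is_derive1_comp _ expR _ _ _ _ _ dN).
  apply: (is_derive_eq (is_deriveM dX dE)).
  rewrite /GRing.scale/= -!exprVn.
  case: n {dX dE} => [|n] /=; first by rewrite expr0; ring.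
  by rewrite !exprS; ring.
- have -> : flat n.+2 0 - n%:R * flat n.+1 0 = 0.
    by rewrite /flat ltxx /= mulr0 subr0.
  exact: is_derive_flat0.
Unshelve. all: by end_near. Qed.

Lemma Dk_flat k n : Dk k (flat n).
Proof.
elim: k n => [//|k IH] n.
exists (flat n.+2 + cst (- n%:R) * flat n.+1); split => [x|].
  apply: is_derive_eq (is_derive_flat n x) _.
  by rewrite !fctE mulNr.
by apply: DkD; [exact: IH|apply: DkM; [exact: Dk_cst|exact: IH]].
Qed.

Lemma flat0_gt0 x : 0 < x -> 0 < flat 0 x.
Proof. by move=> x0; rewrite /flat x0 expr0 mul1r expR_gt0. Qed.

Lemma flat0_le0 x : x <= 0 -> flat 0 x = 0.
Proof. by move=> x0; rewrite /flat ltNge x0. Qed.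

Lemma flat0_ge0 x : 0 <= flat 0 x.
Proof. by case: (ltP 0 x) => [/flat0_gt0/ltW //|/flat0_le0 ->]. Qed.

(** A smooth function equal to 0 on the negative axis and to 1 beyond 1. It
    plays two roles: its derivative is the profile of the angular speed across
    an annulus, and it is the clock along which several flows are performed one
    after the other. *)
Definition step x : R := flat 0 x / (flat 0 x + flat 0 (1 - x)).

Lemma step_den x : flat 0 x + flat 0 (1 - x) != 0.
Proof.
apply: lt0r_neq0; case: (ltP 0 x) => x0.
  by rewrite ltr_pwDl ?flat0_gt0 ?flat0_ge0.
by rewrite ltr_wpDl ?flat0_ge0 ?flat0_gt0 //; lra.
Qed.

Lemma step_le0 x : x <= 0 -> step x = 0.
Proof. by move=> x0; rewrite /step flat0_le0 // mul0r. Qed.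

Lemma step_ge1 x : 1 <= x -> step x = 1.
Proof.
move=> x1; have := step_den x; rewrite /step [flat 0 (1 - x)]flat0_le0 ?subr_le0 //.
by rewrite addr0 => ?; rewrite divff.
Qed.

Lemma Dk_step k : Dk k step.
Proof.
have -> : step =
  flat 0 * (fun x => ((flat 0 + (fun x => flat 0 (-1 * x + 1))) x)^-1).
  by apply/funext => x; rewrite /step !fctE mulN1r [- x + 1]addrC.
apply: DkM; first exact: Dk_flat.
apply: DkV => [x|]; first by rewrite !fctE mulN1r [- x + 1]addrC step_den.
apply: DkD; first exact: Dk_flat.
exact/Dk_affine/Dk_flat.
Qed.

Definition dstep x : R := 'D_1 step x.

Lemma is_derive_step x : is_derive x (1 : R) step (dstep x).
Proof. by have [f' [/(_ x) [? _] _]] := Dk_step 1; exact: derivableP. Qed.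

Lemma Dk_dstep k : Dk k dstep.
Proof.
have [f' [df Df]] := Dk_step k.+1.
suff -> : dstep = f' by [].
by apply/funext => x; have [_ <-] := df x.
Qed.

Lemma continuous_dstep : continuous dstep.
Proof.
move=> x; have [f' [/(_ x) [? _] _]] := Dk_dstep 1.
exact/differentiable_continuous/derivable1_diffP.
Qed.

Lemma near_cst_dstep (c : R) x : (\forall y \near x, step y = c) -> dstep x = 0.
Proof.
move=> stepc; rewrite /dstep -(derive_cst c x 1).
apply: (@near_eq_derive R R^o R^o) => //.
Qed.

Lemma dstep_le0 x : x <= 0 -> dstep x = 0.
Proof.
have lt0 y : y < 0 -> dstep y = 0.
  move=> y0; apply: (near_cst_dstep (c := 0)); near=> z.
  by rewrite step_le0 // ltW //; near: z; exact: lt_nbhsl.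
rewrite le_eqVlt => /orP[/eqP ->|/lt0 //].
have c0 : dstep y @[y --> 0^'-] --> dstep 0.
  exact/cvg_at_left_filter/continuous_dstep.
apply: (cvg_unique _ c0) => //.
apply: cvg_near_cst; near=> y; apply: lt0.
by near: y; exact: nbhs_left_lt.
Unshelve. all: by end_near. Qed.

Lemma dstep_ge1 x : 1 <= x -> dstep x = 0.
Proof.
have gt1 y : 1 < y -> dstep y = 0.
  move=> y0; apply: (near_cst_dstep (c := 1)); near=> z.
  by rewrite step_ge1 // ltW //; near: z; exact: lt_nbhsr.
rewrite le_eqVlt => /orP[/eqP <-|/gt1 //].
have c1 : dstep y @[y --> 1^'+] --> dstep 1.
  exact/cvg_at_right_filter/continuous_dstep.
apply: (cvg_unique _ c1) => //.
apply: cvg_near_cst; near=> y; apply: gt1.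
by near: y; exact: nbhs_right_gt.
Unshelve. all: by end_near. Qed.

(** The mean value theorem: the step climbs from 0 to 1 on an interval of
    length 1. *)
Lemma dstep_eq1 : exists2 t, 0 < t < 1 & dstep t = 1.
Proof.
have [|||t t01] := @MVT _ step dstep 0 1 => //.
- by move=> x _; exact: is_derive_step.
- apply: continuous_subspaceT => x.
  have [? _] := is_derive_step x.
  exact/differentiable_continuous/derivable1_diffP.
rewrite step_ge1 // step_le0 // !subr0 mulr1 => h.
by exists t; [move: t01; rewrite in_itv|].
Qed.

End SmoothStep.

(** * Smooth functions on normed spaces *)

Section SmoothCalculus.
Variables (R : realType) (V : normedModType R).
Implicit Types (f g : V -> R) (k : nat).

Lemma CkW k f : Ck k.+1 setT f -> Ck k setT f.
Proof.
elim: k f => [|k IH] f /= [df Df].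
  by move=> x _; exact/differentiable_continuous/df.
by split => // v; exact: IH.
Qed.

Lemma Ck_cst k (c : R) : Ck k setT (cst c : V -> R).
Proof.
elim: k c => [|k IH] c /=; first by move=> x _; exact: cst_continuous.
split => [x _|v]; first exact: differentiable_cst.
by have -> : 'D_v (cst c : V -> R) = cst 0 by apply/funext => x; exact: derive_cst.
Qed.

Lemma CkD k f g : Ck k setT f -> Ck k setT g -> Ck k setT (f + g).
Proof.
elim: k f g => [|k IH] f g /=.
  by move=> cf cg x _; apply: continuousD; [exact: cf|exact: cg].
move=> [df Df] [dg Dg]; split => [x _|v].
  by apply: differentiableD; [exact: df|exact: dg].
have -> : 'D_v (f + g) = 'D_v f + 'D_v g.
  by apply/funext => x; rewrite deriveD //; apply: diff_derivable; first [exact: df|exact: dg].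
by apply: IH; [exact: Df|exact: Dg].
Qed.

Lemma CkM k f g : Ck k setT f -> Ck k setT g -> Ck k setT (f * g).
Proof.
elim: k f g => [|k IH] f g.
  by move=> cf cg x _; apply: continuousM; [exact: cf|exact: cg].
move=> Cf Cg; have [C'f C'g] := (CkW Cf, CkW Cg).
case: Cf Cg => [df Df] [dg Dg]; split => [x _|v].
  by apply: differentiableM; [exact: df|exact: dg].
have -> : 'D_v (f * g) = f * 'D_v g + g * 'D_v f.
  by apply/funext => x; rewrite deriveM //; apply: diff_derivable; first [exact: df|exact: dg].
by apply: CkD; apply: IH => //; [exact: Dg|exact: Df].
Qed.

Lemma Ck_sum k (I : Type) (r : seq I) (F : I -> V -> R) :
  (forall i, Ck k setT (F i)) -> Ck k setT (\sum_(i <- r) F i).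
Proof.
move=> CF; elim: r => [|i r IH]; first by rewrite big_nil; exact: Ck_cst.
by rewrite big_cons; exact: CkD.
Qed.

(** The condition on l holds for continuous affine functions: their directional
    derivatives are constant, so that every derivative of the composite is a
    constant multiple of a composite of the same shape. *)
Lemma Ck_comp k (g : R -> R) (l : V -> R) :
  (forall x, differentiable l x) ->
  (forall v, exists c : R, 'D_v l = cst c) ->
  (forall k, Dk k g) -> Ck k setT (g \o l).
Proof.
move=> dl Dl; elim: k g => [|k IH] g Dg.
  move=> x _; apply: continuous_comp; first exact/differentiable_continuous.
  have [g' [/(_ (l x)) [? _] _]] := Dg 1%N.
  exact/differentiable_continuous/derivable1_diffP.
have dg y : derivable g y 1 by have [g' [/(_ y) [? _] _]] := Dg 1%N.
split => [x _|v].
  by apply: differentiable_comp => //; apply/derivable1_diffP.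
have [c Dlc] := Dl v.
have -> : 'D_v (g \o l) = cst c * (derive1 g \o l).
  apply/funext => x; rewrite deriveE; last first.
    by apply: differentiable_comp => //; apply/derivable1_diffP.
  rewrite diff_comp //; last exact/derivable1_diffP.
  rewrite /= deriv1E //= -(deriveE v (dl x)) (congr1 (@^~ x) Dlc : derive l x v = c).
  by rewrite !fctE /= derive1E.
apply: CkM; first exact: Ck_cst.
apply: IH => {}k; have [g' [dg' Dg']] := Dg k.+1.
suff -> : derive1 g = g' by [].
by apply/funext => y; rewrite derive1E; have [_ ->] := dg' y.
Qed.

End SmoothCalculus.

Section Coordinates.
Variable R : realType.
Local Notation E := 'rV[R]_3.

(** Testing against all vectors reduces a vector-valued derivative to scalar
    ones, for which the rules of calculus are available. *)
Lemma is_derive_mx (V : normedModType R) (M : V -> E) (t v : V) (D : E) :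
  (forall u, is_derive t v (fun s => dot (M s) u) (dot D u)) ->
  is_derive t v M D.
Proof.
move=> H.
have coordE (w : E) (i : 'I_3) : w 0 i = dot w (delta_mx 0 i).
  rewrite /dot (bigD1 i) //= big1 ?addr0 => [|j ji].
    by rewrite mxE !eqxx mulr1.
  by rewrite mxE (negPf ji) andbF mulr0.
have dM : derivable M t v.
  apply/derivable_mxP => i j; rewrite ord1.
  have -> : (fun x => M x 0 j) = (fun x => dot (M x) (delta_mx 0 j)).
    by apply/funext => x; exact: coordE.
  by have [] := H (delta_mx 0 j).
apply: DeriveDef => //; rewrite derive_mx //; apply/rowP => j; rewrite mxE.
have -> : (fun x => M x 0 j) = (fun x => dot (M x) (delta_mx 0 j)).
  by apply/funext => x; exact: coordE.
by have [_ ->] := H (delta_mx 0 j); rewrite -coordE.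
Qed.

Lemma differentiable_dot (u x : E) : differentiable (fun x => dot x u) x.
Proof.
have -> : (fun x => dot x u) = \sum_(i < 3) (fun x : E => x 0 i * u 0 i).
  by apply/funext => y; rewrite fct_sumE.
apply: differentiable_sum => i; apply: differentiableM => //.
exact: differentiable_coord.
Qed.

Lemma is_derive_dot (V : normedModType R) (M : V -> E) (t v : V) (D u : E) :
  is_derive t v M D -> is_derive t v (fun s => dot (M s) u) (dot D u).
Proof.
move=> [dM <-].
have dc i : derivable (fun x => M x 0 i) t v by move/derivable_mxP: dM; apply.
have -> : (fun s => dot (M s) u) = \sum_(i < 3) (fun s => M s 0 i * u 0 i).
  by apply/funext => y; rewrite fct_sumE.
have H i : is_derive t v (fun s => M s 0 i * u 0 i) ('D_v (fun x => M x 0 i) t * u 0 i).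
  apply: DeriveDef; first exact: derivableM.
  have := @deriveMr _ _ (fun x => M x 0 i) (u 0 i) t v (dc i).
  by rewrite mulrC => <-.
apply: is_derive_eq; rewrite /dot; apply: eq_bigr => i _.
by rewrite derive_mx // mxE.
Qed.

End Coordinates.

(** * Circles on the sphere crossing along a tree *)

Section Circles.
Variable R : realType.
Local Notation E := 'rV[R]_3.

Lemma exists_below (r : seq R) : {in r, forall b, 0 < b} ->
  exists2 eta : R, 0 < eta & {in r, forall b, eta < b}.
Proof.
elim: r => [_|b r IH br]; first by exists 1.
have [a a0 ar] : exists2 eta : R, 0 < eta & {in r, forall b, eta < b}.
  by apply: IH => c cr; apply: br; rewrite inE cr orbT.
have b0 : 0 < b by apply: br; rewrite inE eqxx.
exists (Num.min a (b / 2)); first by rewrite lt_min a0 divr_gt0.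
move=> c; rewrite inE => /orP[/eqP ->|/ar ac]; rewrite gt_min; last by rewrite ac.
by apply/orP; right; lra.
Qed.

(** The circle cut out on the unit sphere by the plane at distance height from
    the origin, orthogonal to axis. The point pt lies on it and is kept off all
    other circles: it is the centre around which circles crossing this one are
    drawn. *)
Record circle := Circle {axis : E; height : R; pt : E}.

Definition ht (c : circle) (x : E) : R := dot x (axis c).

Definition wf_circle c := [/\ dot (axis c) (axis c) = 1,
  dot (pt c) (pt c) = 1, ht c (pt c) = height c & height c ^+ 2 < 1].

(** The circle of c passes on both sides of the circle of c', hence crosses
    it. *)
Definition separates (c c' : circle) := exists q q',
  [/\ dot q q = 1, dot q' q' = 1, ht c q = height c, ht c q' = height c &
      height c' < ht c' q /\ ht c' q' < height c'].

(** A quantitative form of disjointness, in terms of heights only, that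
    survives thickening the circles to annuli. *)
Definition apart (c c' : circle) := exists2 d, 0 < d &
  forall x, dot x x = 1 -> d <= `|ht c x - height c| + `|ht c' x - height c'|.

Definition north : E := vec3 0 0 1.

Lemma dot_north : dot north north = 1.
Proof. by rewrite dot3E !vec3E; ring. Qed.

(** 2 - 2 <x, y> is the square of the distance between the unit vectors x and
    y, so this is the Cauchy-Schwarz inequality. *)
Lemma ht_close c x y : dot (axis c) (axis c) = 1 -> dot x x = 1 -> dot y y = 1 ->
  (ht c x - ht c y) ^+ 2 <= 2 - 2 * dot x y.
Proof.
move=> n1 x1 y1; have := cauchy_schwarz (x - y) (axis c).
by rewrite !dotE n1 x1 y1 (dotC y x) -/(ht c x) -/(ht c y) => h; lra.
Qed.

(** The small circle of radius about sqrt(2 eta) around the marked point of c.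
    Its own marked point is the farthest one from the plane of c on the side of
    its axis; it does not lie on c. *)
Definition child_circle (c : circle) (eta : R) : circle :=
  let h' := 1 - eta in
  Circle (pt c) h' (h' *: pt c + (Num.sqrt (1 - h' ^+ 2) /
     Num.sqrt (1 - height c ^+ 2)) *: (axis c - height c *: pt c)).

Section Child.
Variables (c : circle) (eta : R).
Hypotheses (wfc : wf_circle c) (eta0 : 0 < eta) (eta1 : eta < 1)
  (etah : eta < 1 - height c ^+ 2).
Local Notation h := (height c).
Local Notation n := (axis c).
Local Notation p := (pt c).
Local Notation h' := (1 - eta).
(* For s = 1 and s = -1 these are the points of the small circle that are
    farthest from the plane of c, on either side; the former is its marked
    point. *)
Let child_edge (s : R) := h' *: p + (s * (Num.sqrt (1 - h' ^+ 2) /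
     Num.sqrt (1 - h ^+ 2))) *: (n - h *: p).

Let a0 : 0 < Num.sqrt (1 - h ^+ 2).
Proof. by case: wfc => *; rewrite sqrtr_gt0; lra. Qed.

Let a2 : Num.sqrt (1 - h ^+ 2) ^+ 2 = 1 - h ^+ 2.
Proof. by case: wfc => *; rewrite sqr_sqrtr //; lra. Qed.

Let h'1 : 0 < 1 - h' ^+ 2.
Proof.
have : 0 < eta * (2 - eta) by apply: mulr_gt0 => //; move: eta1; lra.
by rewrite expr2; lra.
Qed.

Let b2 : Num.sqrt (1 - h' ^+ 2) ^+ 2 = 1 - h' ^+ 2.
Proof. by rewrite sqr_sqrtr // ltW. Qed.

Lemma child_edge_pt s : dot (child_edge s) p = h'.
Proof.
case: wfc => nn pp; rewrite /ht => np _.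
by rewrite /child_edge !dotE pp (dotC n) np; ring.
Qed.

Lemma child_edge_unit s : s ^+ 2 = 1 -> dot (child_edge s) (child_edge s) = 1.
Proof.
case: wfc => nn pp; rewrite /ht => np _ s2.
rewrite /child_edge !dotE pp (dotC n) np nn.
set A := Num.sqrt (1 - h ^+ 2); set B := Num.sqrt (1 - h' ^+ 2).
transitivity (h' ^+ 2 + s ^+ 2 * B ^+ 2 * ((1 - h ^+ 2) / A ^+ 2)).
  by field; rewrite gt_eqF.
rewrite s2 a2 b2 divff; first by ring.
by rewrite -a2 gt_eqF // exprn_gt0.
Qed.

Lemma child_edge_ht s : ht c (child_edge s) =
  h' * h + s * (Num.sqrt (1 - h' ^+ 2) * Num.sqrt (1 - h ^+ 2)).
Proof.
case: wfc => nn pp; rewrite /ht => np _.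
rewrite /child_edge !dotE np nn.
set A := Num.sqrt (1 - h ^+ 2); set B := Num.sqrt (1 - h' ^+ 2).
transitivity (h' * h + s * (B * (A ^+ 2 / A))).
  by rewrite a2; field; rewrite gt_eqF.
by congr (_ + _ * (_ * _)); field; rewrite gt_eqF.
Qed.

(** The lateral deviation of the small circle from the plane of c is of order
    sqrt(eta), whereas its centre moves only by order eta along the normal: so
    both sides of c are reached. After squaring, the inequality follows from
    eta < 1 - h^2. *)
Lemma child_gap : `|h| * eta < Num.sqrt (1 - h' ^+ 2) * Num.sqrt (1 - h ^+ 2).
Proof.
rewrite -(@ltr_pXn2r _ 2) ?nnegrE ?mulr_ge0 ?sqrtr_ge0 ?(ltW eta0) //.
rewrite !exprMn a2 b2 real_normK ?num_real //.
have [_ _ _ h1] := wfc.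
have q0 : 0 < 1 - h ^+ 2 by rewrite subr_gt0.
have k1 : 0 < eta * (1 - h ^+ 2 - eta) by rewrite mulr_gt0 // subr_gt0.
have k2 : 0 < eta * (1 - eta) * (1 - h ^+ 2) by rewrite !mulr_gt0 // subr_gt0.
have k3 : 0 < (1 - h ^+ 2) * eta ^+ 2 by rewrite mulr_gt0 // exprn_gt0.
lra.
Qed.

Lemma child_edge1_gt : h < ht c (child_edge 1).
Proof.
have := child_gap; rewrite child_edge_ht mul1r.
have : h * eta <= `|h| * eta by rewrite ler_wpM2r ?ler_norm // ltW.
by lra.
Qed.

Lemma child_edgeN1_lt : ht c (child_edge (-1)) < h.
Proof.
have := child_gap; rewrite child_edge_ht mulN1r.
have : - h * eta <= `|h| * eta by rewrite ler_wpM2r ?(ltW eta0) // -(normrN h) ler_norm.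
by lra.
Qed.

Let pt_child : pt (child_circle c eta) = child_edge 1.
Proof. by rewrite /child_edge mul1r. Qed.

Lemma child_wf : wf_circle (child_circle c eta).
Proof.
split; rewrite ?pt_child /ht.
- by case: wfc.
- by rewrite child_edge_unit // expr1n.
- by rewrite child_edge_pt.
- by rewrite -subr_gt0.
Qed.

Lemma child_ht_pt : h < ht c (pt (child_circle c eta)).
Proof. by rewrite pt_child child_edge1_gt. Qed.

Lemma child_separates : separates (child_circle c eta) c.
Proof.
exists (child_edge 1), (child_edge (-1)); rewrite /ht !child_edge_pt.
by rewrite !child_edge_unit ?sqrrN ?expr1n // child_edge1_gt child_edgeN1_lt.
Qed.

(** The marked point itself is inside the small circle; its antipode on c, the
    point 2 h n - p, is outside. *)
Lemma parent_separates : separates c (child_circle c eta).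
Proof.
case: (wfc) => nn pp; rewrite /ht => np h1.
exists p, ((2 * h) *: n - p); rewrite /ht /= !dotE pp nn np (dotC n) np.
split; [by []|by ring|by []|by ring|].
by move: eta0 etah => e0 eh; split; lra.
Qed.

(** A unit vector whose height over the small circle is off by less than eta is
    within distance 2 sqrt(eta) of the centre, so its height over c' differs
    from that of the centre by at most half of the gap between the centre and
    c'. *)
Lemma child_dist (c' : circle) x : dot (axis c') (axis c') = 1 -> dot x x = 1 ->
  16 * eta <= (ht c' p - height c') ^+ 2 ->
  Num.min eta (`|ht c' p - height c'| / 2) <=
    `|ht (child_circle c eta) x - height (child_circle c eta)| +
    `|ht c' x - height c'|.
Proof.
case: (wfc) => nn pp _ h1 n1 x1 le16.
set d := `|_ - _| / 2; set e := `|_ - _|.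
have [ee|ee] := leP eta e; first by rewrite ge_min; apply/orP; left; rewrite ler_wpDr.
rewrite ge_min; apply/orP; right; rewrite ler_wpDl ?normr_ge0 //.
have cl := ht_close n1 x1 pp.
move: ee; rewrite /e /= /ht ltr_norml => /andP[e1 _].
have cl4 : (ht c' x - ht c' p) ^+ 2 <= d ^+ 2.
  by rewrite /d expr_div_n real_normK ?num_real //; move: cl e1 le16; rewrite /ht; lra.
have : `|ht c' x - ht c' p| <= d.
  by rewrite -(@ler_pXn2r _ 2) ?nnegrE ?divr_ge0 // real_normK ?num_real.
have := ler_distD (ht c' x) (ht c' p) (height c').
rewrite (distrC (ht c' p) (ht c' x)) /d; lra.
Qed.

Lemma child_apart (c' : circle) : dot (axis c') (axis c') = 1 ->
  ht c' p != height c' ->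
  16 * eta <= (ht c' p - height c') ^+ 2 ->
  apart (child_circle c eta) c'.
Proof.
move=> n1 pc' le16; exists (Num.min eta (`|ht c' p - height c'| / 2)).
  by rewrite lt_min eta0 divr_gt0 // normr_gt0 subr_eq0.
by move=> x x1; exact: child_dist.
Qed.

Lemma child_ht_pt_neq (c' : circle) : dot (axis c') (axis c') = 1 ->
  ht c' p != height c' ->
  16 * eta <= (ht c' p - height c') ^+ 2 ->
  ht c' (pt (child_circle c eta)) != height c'.
Proof.
move=> n1 pc' le16; have [_ pp1 pp2 _] := child_wf.
have := child_dist n1 pp1 le16.
rewrite pp2 subrr normr0 add0r => h0.
rewrite -subr_eq0 -normr_gt0; apply: lt_le_trans h0.
by rewrite lt_min eta0 divr_gt0 // normr_gt0 subr_eq0.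
Qed.

Lemma child_ht_neq x : dot x x = 1 ->
  (dot x p < 1 -> eta < 1 - dot x p) ->
  ht (child_circle c eta) x != height (child_circle c eta).
Proof.
move=> x1 lt1; rewrite /ht /=; move: eta0.
have [/lt1 ? _|? ?] := ltP (dot x p) 1; first by rewrite lt_eqF //; lra.
by rewrite gt_eqF //; lra.
Qed.

End Child.

Lemma apartC c c' : apart c c' -> apart c' c.
Proof. by case=> d d0 h; exists d => // x x1; rewrite addrC h. Qed.

Section Config.
Variable T : eqType.
Implicit Types (s t : seq T) (L : seq (seq T)) (C : seq T -> circle).

Definition child_of s t := (s != [::]) && (behead s == t).
(** Finite sequences form a tree in which the parent of a nonempty sequence is
    its tail; this is the adjacency relation of that tree. *)
Definition adj s t := child_of s t || child_of t s.

Lemma adjC s t : adj s t = adj t s.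
Proof. by rewrite /adj orbC. Qed.

(** A configuration of circles indexed by a finite set of sequences closed
    under taking parents, in which circles cross exactly along the edges of the
    tree and avoid the north pole. *)
Record config L C : Prop := Config {
  config_nil : [::] \in L;
  config_behead : forall s, s \in L -> behead s \in L;
  config_wf : forall s, s \in L -> wf_circle (C s);
  config_north : forall s, s \in L -> ht (C s) north != height (C s);
  config_free : forall s t, s \in L -> t \in L -> s != t ->
    ht (C t) (pt (C s)) != height (C t);
  config_adj : forall s t, s \in L -> t \in L -> adj s t -> separates (C s) (C t);
  config_apart : forall s t, s \in L -> t \in L -> s != t -> ~~ adj s t ->
    apart (C s) (C t)
}.

Lemma config1 : exists C, config [:: [::]] C.
Proof.
exists (fun=> Circle north 0 (vec3 1 0 0)); split=> [|s|s|s|s t|s t|s t];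
  rewrite ?inE ?dot_north //; do ?move=> /eqP ->; rewrite ?inE //.
- split; rewrite /= ?dot_north /ht /=; first by [].
  + by rewrite dot3E !vec3E; ring.
  + by rewrite dot3E !vec3E; ring.
  + by rewrite expr0n.
- by rewrite /ht dot_north oner_eq0.
Qed.

(** Grafting a new leaf: a sufficiently small circle around the marked point of
    its parent crosses the parent only, since the marked point is at a positive
    distance from the other circles. Several children of the same node become
    concentric circles of different radii. *)
Lemma config_cons L C y s : config L C -> s \in L -> y :: s \notin L ->
  exists C', config ((y :: s) :: L) C'.
Proof.
move=> [cnil cbeh cwf cnorth cfree cadj capart] sL ysL.
have wfs := cwf s sL; have [nn pp np h1] := wfs.
(* bnd x is a bound on eta that keeps the unit vector x off the new circle; if
    x is at its centre every eta works. *)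
pose bnd (x : E) : R := if dot x (pt (C s)) < 1 then 1 - dot x (pt (C s)) else 1.
have bnd0 x : 0 < bnd x by rewrite /bnd; case: ifP => // ?; lra.
pose sq t := if t == s then 1 else (ht (C t) (pt (C s)) - height (C t)) ^+ 2 / 16.
have [eta eta0 etaP] : exists2 eta : R, 0 < eta & {in [:: 1; 1 - height (C s) ^+ 2;
    bnd north] ++ [seq bnd (pt (C t)) | t <- L] ++ [seq sq t | t <- L],
    forall b, eta < b}.
  apply: exists_below => b; rewrite !mem_cat !inE -!orbA.
  case/or4P; [by move=> /eqP ->|by move=> /eqP ->; lra|by move=> /eqP ->|].
  case/orP => /mapP[t tL ->] //.
  rewrite /sq; case: eqP => // /eqP ts.
  by rewrite divr_gt0 // exprn_even_gt0 //= subr_eq0 cfree // eq_sym.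
have eta1 : eta < 1 by apply: etaP; rewrite !inE eqxx.
have etah : eta < 1 - height (C s) ^+ 2 by apply: etaP; rewrite !inE eqxx orbT.
have etaN : eta < bnd north by apply: etaP; rewrite !inE eqxx !orbT.
have etab t : t \in L -> eta < bnd (pt (C t)).
  by move=> tL; apply: etaP; rewrite !mem_cat (map_f (fun t => bnd (pt (C t))) tL) orbT.
have eta16 t : t \in L -> t != s ->
    16 * eta <= (ht (C t) (pt (C s)) - height (C t)) ^+ 2.
  move=> tL ts; have : eta < sq t.
    by apply: etaP; rewrite !mem_cat (map_f sq tL) !orbT.
  by rewrite /sq (negPf ts); lra.
have bndP x : eta < bnd x -> dot x (pt (C s)) < 1 -> eta < 1 - dot x (pt (C s)).
  by rewrite /bnd => + x1; rewrite x1.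
have nys t : t \in L -> (t == y :: s) = false.
  by move=> tL; apply: contraNF ysL => /eqP <-.
have adjys t : t \in L -> adj (y :: s) t = (s == t).
  move=> tL; rewrite /adj /child_of /= orbC; case: andP => // -[t0 /eqP ts].
  by case/negP: ysL; rewrite -ts cbeh.
have wfn := child_wf wfs eta0 eta1.
exists (fun t => if t == y :: s then child_circle (C s) eta else C t).
split=> [|t|t|t|t u|t u|t u].
- by rewrite inE cnil orbT.
- rewrite !inE => /orP[/eqP ->|/cbeh ->]; last by rewrite orbT.
  by rewrite /= sL orbT.
- by rewrite inE; case: eqP => //= _ /cwf.
- rewrite inE; case: eqP => [_ _|_ /cnorth //].
  by apply: (child_ht_neq eta0); [exact: dot_north|exact: bndP].
- rewrite !inE; case: (eqVneq t (y :: s)) => [-> _|tys /= tL];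
    case: (eqVneq u (y :: s)) => [-> _|uys /= uL].
  + by rewrite ?eqxx.
  + move=> _; have [uu _ _ _] := cwf u uL.
    case: (eqVneq u s) => [->|us]; first by rewrite gt_eqF // child_ht_pt.
    by apply: child_ht_pt_neq => //; [rewrite cfree // eq_sym|exact: eta16].
  + move=> _; apply: (child_ht_neq eta0); first by case: (cwf t tL).
    exact/bndP/etab.
  + exact: cfree.
- rewrite !inE; case: (eqVneq t (y :: s)) => [-> _|tys /= tL];
    case: (eqVneq u (y :: s)) => [-> _|uys /= uL].
  + rewrite /adj /child_of /= orbb => /eqP/(congr1 size)/= /eqP.
    by rewrite eqn_leq ltnn andbF.
  + by rewrite adjys // => /eqP <-; exact: child_separates.
  + by rewrite adjC adjys // => /eqP <-; exact: parent_separates.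
  + exact: cadj.
- rewrite !inE; case: (eqVneq t (y :: s)) => [-> _|tys /= tL];
    case: (eqVneq u (y :: s)) => [-> _|uys /= uL].
  + by rewrite ?eqxx.
  + rewrite adjys // => _ su; have [uu _ _ _] := cwf u uL.
    by apply: child_apart => //; [exact: cfree|apply: eta16; rewrite // eq_sym].
  + rewrite adjC adjys // => _ su; have [uu _ _ _] := cwf t tL.
    apply: apartC.
    by apply: child_apart => //; [exact: cfree|apply: eta16; rewrite // eq_sym].
  + exact: capart.
Qed.

Lemma config_add L C s : config L C ->
  exists L' C', [/\ config L' C', {subset L <= L'} & s \in L'].
Proof.
move=> LC; elim: s => [|y s [L' [C' [LC' sub sL']]]].
  by exists L, C; split => //; case: LC.
case: (boolP (y :: s \in L')) => [ys|ys]; first by exists L', C'.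
have [C'' LC''] := config_cons LC' sL' ys.
exists ((y :: s) :: L'), C''; split => //; last by rewrite inE eqxx.
by move=> t /sub tL'; rewrite inE tL' orbT.
Qed.

Lemma config_exists (M : seq (seq T)) :
  exists L C, config L C /\ {subset M <= L}.
Proof.
elim: M => [|s M [L [C [LC sub]]]].
  by have [C LC] := config1; exists [:: [::]], C.
have [L' [C' [LC' sub' sL']]] := config_add s LC.
exists L', C'; split => // t; rewrite inE => /orP[/eqP -> //|/sub /sub'//].
Qed.

End Config.
End Circles.

(** * Twists of annuli and the curves that cross them *)

Section Crossing.
Variable R : realType.
Local Notation E := 'rV[R]_3.

Definition between (a b s : R) := (a <= s <= b) || (b <= s <= a).

Lemma betweenC a b s : between a b s = between b a s.
Proof. by rewrite /between orbC. Qed.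

Lemma between_trans a b c d s : between a b c -> between a b d ->
  between c d s -> between a b s.
Proof.
rewrite /between => /orP[]/andP[? ?] /orP[]/andP[? ?] /orP[]/andP[? ?];
  apply/orP; first [left; lra|right; lra].
Qed.

(** The endpoints may come in any order: the curves below are followed in
    whichever direction the twist turns. *)
Lemma IVT_between (f : R -> R) (a b v : R) :
  (forall s, between a b s -> {for s, continuous f}) ->
  between (f a) (f b) v -> exists2 c, between a b c & f c = v.
Proof.
wlog ab : a b / a <= b.
  move=> wl cf vab; have [/wl|/ltW/wl ba] := leP a b; first exact.
  have [s||c cba fc] := ba.
  - by rewrite betweenC; exact: cf.
  - by rewrite betweenC.
  - by exists c => //; rewrite betweenC.
move=> cf vab; have [||c] := @IVT R f a b v ab.
- apply: continuous_in_subspaceT => s; rewrite inE /= in_itv/= => sab.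
  by apply: cf; rewrite /between sab.
- by rewrite ge_min le_max; move: vab => /orP[]/andP[-> ->]; rewrite ?orbT.
by rewrite in_itv/= => cab fc; exists c => //; rewrite /between cab.
Qed.

(** The level set of the values at least B is compact in the interval, so it
    has a least element; the intermediate value theorem identifies the value
    there. *)
Lemma first_reach (f : R -> R) (a b B : R) : continuous f -> a <= b ->
  f a < B -> B <= f b ->
  exists c, [/\ a <= c <= b, f c = B & forall s, a <= s <= c -> f s <= B].
Proof.
move=> cf ab faB Bfb.
pose S := `[a, b] `&` [set s | B <= f s].
have cS : compact S.
  apply: compact_closedI; first exact: segment_compact.
  by apply: (preimage_closed (D := [set y | B <= y])) => //; exact: closed_ge.
have S0 : S !=set0 by exists b; split => //=; rewrite in_itv/= ab lexx.
have [c] : exists2 c, c \in S & forall t, t \in S -> c <= t.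
  apply: (@compact_EVT_min _ _ (fun x : R => x)) => //.
  by apply: continuous_subspaceT => x; exact: cvg_id.
rewrite inE /S /= in_itv/= => -[/andP[ac cb] Bc] minc.
have cE : f c = B.
  have [||d dac fd] := @IVT_between f a c B.
  - by move=> s _; exact: cf.
  - by rewrite /between (ltW faB) Bc.
  suff -> : c = d by [].
  have /andP[ad dc] : a <= d <= c.
    by move: dac; rewrite /between => /orP[//|/andP[? ?]]; apply/andP; lra.
  apply/eqP; rewrite eq_le dc andbT; apply: minc.
  by rewrite inE /= in_itv/= ad fd lexx (le_trans dc cb).
exists c; split => //; first by rewrite ac cb.
move=> s /andP[as_ sc]; rewrite leNgt; apply/negP => Bs.
have cs : c <= s.
  by apply: minc; rewrite inE /= in_itv/= as_ (ltW Bs) (le_trans sc cb).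
by move: Bs; rewrite (_ : s = c) ?cE ?ltxx //; apply/eqP; rewrite eq_le sc cs.
Qed.

(** A last exit from the values at most A, followed by a first entrance to the
    values at least B, cuts out a piece along which f stays between A and B. *)
Lemma sub_crossing (f : R -> R) (a b A B : R) : continuous f -> A < B ->
  f a <= A -> B <= f b ->
  exists a' b', [/\ f a' = A, f b' = B &
    forall s, between a' b' s -> A <= f s <= B /\ between a b s].
Proof.
move=> cf AB.
wlog ab : f a b cf / a <= b.
  move=> wl fa fb; have [ab|/ltW ab] := leP a b; first exact: (wl f a b).
  have cNf : continuous (fun s => f (- s)).
    by move=> s; apply: continuous_comp; [exact: opp_continuous|exact: cf].
  have [|||a' [b' [fa' fb' H]]] := wl (fun s => f (- s)) (- a) (- b) cNf.
  - by rewrite lerN2.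
  - by rewrite opprK.
  - by rewrite opprK.
  exists (- a'), (- b'); split => // s sab.
  have [|H1 H2] := H (- s).
    by move: sab; rewrite /between => /orP[]/andP[? ?]; apply/orP;
      [right|left]; lra.
  rewrite opprK in H1; split => //.
  by move: H2; rewrite /between !lerN2 orbC andbC [X in _ || X]andbC.
move=> fa fb.
have [b' [/andP[ab' b'b] fb' ltB]] := first_reach cf ab (le_lt_trans fa AB) fb.
have cg : continuous (fun s => - f (- s)).
  move=> s; apply: cvgN; apply: continuous_comp; last exact: cf.
  exact: opp_continuous.
have [|||a' [/andP[b'a' a'a] fa' geA]] := @first_reach _ (- b') (- a) (- A) cg.
- by rewrite lerN2.
- by rewrite opprK fb' ltrN2.
- by rewrite opprK lerN2.
exists (- a'), b'; split => //; first by apply: oppr_inj.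
have a'b' : - a' <= b' by rewrite lerNl.
move=> s; rewrite /between => sab.
have /andP[s1 s2] : - a' <= s <= b'.
  by move: sab => /orP[//|/andP[? ?]]; apply/andP; lra.
split; last by apply/orP; left; apply/andP; split; lra.
apply/andP; split; last by apply: ltB; apply/andP; split; lra.
have : - b' <= - s <= a' by apply/andP; split; lra.
by move=> /geA; rewrite opprK lerN2.
Qed.

Lemma unit_angle (a b : R) : a ^+ 2 + b ^+ 2 = 1 ->
  exists t, [/\ - pi <= t <= pi, cos t = a & sin t = b].
Proof.
move=> ab1; exists (if 0 <= b then acos a else - acos a).
have a1 : -1 <= a <= 1.
  by rewrite -ler_norml -(@ler_pXn2r _ 2) ?nnegrE // expr1n real_normK ?num_real //;
    have := sqr_ge0 b; lra.
have [p0 p1] := (acos_ge0 a1, acos_lepi a1).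
have := pi_gt0 R => pi0.
have b2 : Num.sqrt (1 - a ^+ 2) = `|b|.
  by rewrite (_ : 1 - a ^+ 2 = b ^+ 2) ?sqrtr_sqr //; lra.
case: ifPn => b0; rewrite ?cosN ?sinN acosK ?in_itv //= sin_acos // b2.
  by rewrite ger0_norm //; split => //; lra.
by rewrite ltr0_norm ?ltNge // opprK; split => //; lra.
Qed.

(** The angle of the vector (a, b) of length r, by the half-angle formula. It
    is continuous off the ray b = 0, a <= 0, where r + a vanishes. *)
Definition angle_of (r a b : R) : R := 2 * atan (b / (r + a)).

Lemma angle_of_lt r a b : - pi < angle_of r a b < pi.
Proof.
rewrite /angle_of; have := atan_gtNpi2 (b / (r + a)); have := atan_ltpi2 (b / (r + a)).
by move=> ? ?; apply/andP; split; lra.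
Qed.

Lemma angle_ofP r a b : 0 < r -> a ^+ 2 + b ^+ 2 = r ^+ 2 -> r + a != 0 ->
  r * cos (angle_of r a b) = a /\ r * sin (angle_of r a b) = b.
Proof.
move=> r0 ab ra; rewrite /angle_of !mulr_natl.
rewrite cos_mulr2n sin_mulr2n.
set u := b / (r + a).
have cu : cos (atan u) ^+ 2 = (1 + u ^+ 2)^-1.
  by rewrite cos_atan exprVn sqr_sqrtr // addr_ge0 // sqr_ge0.
have c0 : cos (atan u) != 0.
  by rewrite cos_atan invr_eq0 gt_eqF // sqrtr_gt0 ltr_pwDl // sqr_ge0.
have su : sin (atan u) = u * cos (atan u).
  by rewrite -[X in _ = X * _](atanK u) /tan divfK.
have uE : 1 + u ^+ 2 = 2 * r / (r + a).
  rewrite /u expr_div_n (_ : b ^+ 2 = r ^+ 2 - a ^+ 2); last by rewrite -ab; ring.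
  by field.
have -> : cos (atan u) * sin (atan u) = u * (1 + u ^+ 2)^-1.
  by rewrite su -cu; ring.
rewrite cu uE invf_div !mulr2n; split; rewrite /u; field.
  by rewrite gt_eqF.
by rewrite ra gt_eqF.
Qed.

(** Continuity of a curve tested on linear forms, the form in which it is
    produced by Rodrigues' formula and used through heights. *)
Definition wcont (g : R -> E) := forall u, continuous (fun s => dot (g s) u).

Definition peak : R := s2val (cid2 (dstep_eq1 R)).

Lemma peakP : 0 < peak < 1 /\ dstep peak = 1.
Proof. by rewrite /peak; case: cid2. Qed.

Section Band.
Variable eps : R.
Hypothesis eps0 : 0 < eps.

Definition band (c : circle R) (x : E) := `|ht c x - height c| <= eps.

Definition lo (c : circle R) := height c - eps.
(** The curves are followed across the part of the annulus between the level
    lo, where the twist does not move, and the level hi, where it turns by the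
    full angle given by its speed. *)
Definition hi (c : circle R) := lo c + 2 * eps * peak.

(** The angle per unit time by which the points of height z turn. The factor 6
    pi is three full turns: the position of a curve inside the annulus accounts
    for less than half a turn at either end, so that the twisted curve still
    makes two. *)
Definition speed (c : circle R) (z : R) : R :=
  6 * pi * dstep ((z - lo c) / (2 * eps)).

Definition twist (c : circle R) (t : R) (x : E) : E :=
  rotation (axis c) (t * speed c (ht c x)) x.

Lemma lo_lt_hi c : lo c < hi c.
Proof. by rewrite /hi ltrDl !mulr_gt0 //; case: peakP => /andP[]. Qed.

Lemma hi_lt c : hi c < height c + eps.
Proof.
have [/andP[p0 p1] _] := peakP.
have : 2 * eps * peak < 2 * eps by rewrite gtr_pMr // mulr_gt0.
by rewrite /hi /lo; lra.
Qed.

Lemma lo_hi_band c x : lo c <= ht c x <= hi c -> band c x.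
Proof.
have := hi_lt c; rewrite /band /lo ler_norml => ? /andP[? ?].
by apply/andP; split; lra.
Qed.

Lemma speed_out c z : eps <= `|z - height c| -> speed c z = 0.
Proof.
rewrite /speed /lo ler_normr => /orP[] h.
  by rewrite dstep_ge1 ?mulr0 // ler_pdivlMr ?mulr_gt0 //; lra.
by rewrite dstep_le0 ?mulr0 // ler_pdivrMr ?mulr_gt0 //; lra.
Qed.

Lemma speed_lo c : speed c (lo c) = 0.
Proof. by rewrite /speed subrr mul0r dstep_le0 // mulr0. Qed.

Lemma speed_hi c : speed c (hi c) = 6 * pi.
Proof.
have -> : speed c (hi c) = 6 * pi * dstep peak; last first.
  by case: peakP => _ ->; rewrite mulr1.
by congr (_ * dstep _); rewrite /hi; field; rewrite gt_eqF.
Qed.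

Lemma continuous_speed c : continuous (speed c).
Proof.
move=> z; apply: cvgM; first exact: cvg_cst.
apply: (continuous_comp (f := fun z => (z - lo c) / (2 * eps))); last exact: continuous_dstep.
apply: cvgM; last exact: cvg_cst.
by apply: cvgB; [exact: cvg_id|exact: cvg_cst].
Qed.

Section Twist.
Variable c : circle R.
Hypothesis nn : dot (axis c) (axis c) = 1.

Lemma ht_twist t x : ht c (twist c t x) = ht c x.
Proof. by rewrite /ht (dot_rotation_axis nn). Qed.

Lemma dot_twist t x : dot (twist c t x) (twist c t x) = dot x x.
Proof. exact: dot_rotation. Qed.

(** The height over the axis is invariant, so each circle of the annulus turns
    with a constant speed. *)
Lemma twistD s t x : twist c (s + t) x = twist c s (twist c t x).
Proof. by rewrite /twist mulrDl (rotationD nn) /ht (dot_rotation_axis nn). Qed.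

Lemma twist0 x : twist c 0 x = x.
Proof. by rewrite /twist mul0r rotation0. Qed.

Lemma twist_out t x : ~~ band c x -> twist c t x = x.
Proof.
rewrite /band -ltNge => h; rewrite /twist speed_out ?mulr0 ?rotation0 //.
exact: ltW.
Qed.

Lemma wcont_twist t g : wcont g -> wcont (fun s => twist c t (g s)).
Proof.
move=> cg u; pose th s := t * speed c (ht c (g s)).
have cth : continuous th.
  move=> s; apply: cvgM; first exact: cvg_cst.
  by apply: (continuous_comp (f := fun s => ht c (g s))); [exact: cg|exact: continuous_speed].
have -> : (fun s => dot (twist c t (g s)) u) = (fun s =>
   cos (th s) * dot (g s) u + sin (th s) * dot (g s) (cross u (axis c)) +
   ((1 - cos (th s)) * dot (g s) (axis c)) * dot (axis c) u).
  by apply/funext => s; rewrite !dotE dot_cross (dotC (axis c) (g s)).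
have cc : continuous (fun s => cos (th s)).
  by move=> s; apply: (continuous_comp (f := th)); [exact: cth|exact: continuous_cos].
have cs : continuous (fun s => sin (th s)).
  by move=> s; apply: (continuous_comp (f := th)); [exact: cth|exact: continuous_sin].
move=> s; apply: cvgD; first apply: cvgD.
- by apply: cvgM; [exact: cc|exact: cg].
- by apply: cvgM; [exact: cs|exact: cg].
- apply: cvgM; last exact: cvg_cst.
  apply: cvgM; last exact: cg.
  by apply: cvgB; [exact: cvg_cst|exact: cc].
Qed.

End Twist.

(** A piece of the curve g goes across the inner part of the annulus of c while
    staying inside the annulus of c'. *)
Definition crosses (c c' : circle R) (g : R -> E) := exists s0 s1,
  [/\ ht c (g s0) = lo c, ht c (g s1) = hi c & forall s, between s0 s1 s ->
      lo c <= ht c (g s) <= hi c /\ band c' (g s)].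

(** The point of height z on the meridian that leaves the axis in the direction
    of the unit vector e orthogonal to it. *)
Definition meridian_pt (c : circle R) (e : E) (z : R) : E :=
  z *: axis c + Num.sqrt (1 - z ^+ 2) *: e.

(** The annulus of c contains two entire meridian arcs, one above and one below
    the annulus of c'. The first will also serve as a cut: a curve in the
    intersection of both annuli never meets it, so its angle about the axis of
    c is a continuous function. *)
Definition sticks_out (c c' : circle R) := exists e e',
  [/\ dot e e = 1, dot e (axis c) = 0, dot e' e' = 1, dot e' (axis c) = 0 &
    forall z, `|z - height c| <= eps ->
      height c' + eps < ht c' (meridian_pt c e z) /\
      ht c' (meridian_pt c e' z) < height c' - eps].

Lemma twist_angle c f t x r a :
  dot (axis c) (axis c) = 1 -> dot f f = 1 -> dot f (axis c) = 0 ->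
  r * cos a = dot x f -> r * sin a = dot x (cross (axis c) f) ->
  twist c t x = ht c x *: axis c +
    (r * cos (a + t * speed c (ht c x))) *: f +
    (r * sin (a + t * speed c (ht c x))) *: cross (axis c) f.
Proof.
move=> nn ff fn ra rb.
rewrite (frame_decomp (twist c t x) nn ff fn) -/(ht c _) ht_twist //.
rewrite /twist dot_rotation_frame // dot_rotation_frame' // -ra -rb cosD sinD.
by congr (_ + _ *: _ + _ *: _); ring.
Qed.

(** The heart of the ping-pong. The curve crosses the annulus of c inside the
    annulus of c', hence off a meridian, so its angle varies within one turn.
    The twist adds an angle running from 0 to 6 pi k. Therefore the twisted
    curve meets every meridian of the annulus of c, among them one on each side
    of the annulus of c'', and between the two it crosses that annulus without
    leaving the annulus of c. *)
Lemma twist_crosses c c' c'' g (k : int) :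
  dot (axis c) (axis c) = 1 -> (forall z, `|z - height c| <= eps -> z ^+ 2 < 1) ->
  sticks_out c c' -> sticks_out c c'' -> k != 0 ->
  wcont g -> (forall s, dot (g s) (g s) = 1) ->
  crosses c c' g -> crosses c'' c (fun s => twist c k%:~R (g s)).
Proof.
move=> nn hz [e [e0 [ee en _ _ out1]]] [e1 [e2 [ee1 en1 ee2 en2 out2]]] k0 cg gg.
move=> [s0 [s1 [gs0 gs1 gs]]].
(* Angles are measured from the direction opposite to the cut e. *)
pose f := - e.
have ff : dot f f = 1 by rewrite /f !dotE ee; ring.
have fn : dot f (axis c) = 0 by rewrite /f !dotE en oppr0.
have gband s : between s0 s1 s -> `|ht c (g s) - height c| <= eps.
  by move=> /gs[/lo_hi_band].
pose r s := Num.sqrt (1 - ht c (g s) ^+ 2).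
have r2 s : between s0 s1 s -> r s ^+ 2 = 1 - ht c (g s) ^+ 2.
  by move=> /gband/hz h; rewrite sqr_sqrtr // subr_ge0 ltW.
have r0 s : between s0 s1 s -> 0 < r s.
  by move=> /gband/hz h; rewrite sqrtr_gt0 subr_gt0.
pose a s := dot (g s) f; pose b s := dot (g s) (cross (axis c) f).
have ab s : between s0 s1 s -> a s ^+ 2 + b s ^+ 2 = r s ^+ 2.
  move=> /r2 ->; have := frame_norm (g s) nn ff fn.
  by rewrite gg /ht /a /b; lra.
have ra s : between s0 s1 s -> r s + a s != 0.
  move=> bs; apply/eqP => ra0.
  have b0 : b s = 0.
    apply/eqP; rewrite -sqrf_eq0; apply/eqP.
    by have := ab s bs; rewrite (_ : a s = - r s) ?sqrrN; lra.
  have [_] := gs s bs; rewrite /band ler_norml => /andP[_].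
  have [+ _] := out1 _ (gband s bs).
  suff -> : meridian_pt c e (ht c (g s)) = g s by lra.
  rewrite [RHS](frame_decomp _ nn ff fn) -/(a s) -/(b s) b0 scale0r addr0.
  by rewrite /meridian_pt -/(r s) (_ : a s = - r s) ?scaleNr /f ?scalerN ?opprK //; lra.
(* The angle of the twisted curve: its variation exceeds a full turn. *)
pose D s := angle_of (r s) (a s) (b s) + k%:~R * speed c (ht c (g s)).
have cht : continuous (fun s => ht c (g s)) by exact: cg.
have cr : continuous r.
  move=> s; apply: (continuous_comp (f := fun s => 1 - ht c (g s) ^+ 2)).
    apply: cvgB; first exact: cvg_cst.
    by apply: cvgM; exact: cht.
  exact: sqrt_continuous.
have cD s : between s0 s1 s -> {for s, continuous D}.
  move=> bs; apply: cvgD; last first.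
    apply: cvgM; first exact: cvg_cst.
    by apply: (continuous_comp (f := fun s => ht c (g s))); [exact: cht|exact: continuous_speed].
  apply: cvgM; first exact: cvg_cst.
  apply: (continuous_comp (f := fun s => b s / (r s + a s))); last exact: continuous_atan.
  apply: cvgM; first exact: cg.
  apply: cvgV; first exact: ra.
  by apply: cvgD; [exact: cr|exact: cg].
(* Every meridian of the annulus is met by the twisted curve. The target angle
    is shifted by one turn in the direction of the twist, which puts it inside
    the range of D whatever the two end positions are. *)
have reach e' : dot e' e' = 1 -> dot e' (axis c) = 0 -> exists2 s,
    between s0 s1 s & twist c k%:~R (g s) = meridian_pt c e' (ht c (g s)).
  move=> ee' en'.
  have [|be [/andP[be1 be2] cosb sinb]] := @unit_angle (dot e' f) (dot e' (cross (axis c) f)).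
    by have := frame_norm e' nn ff fn; rewrite ee' en'; lra.
  have [s bs Ds] : exists2 s, between s0 s1 s &
      D s = be + (if 0 < k then 2 * pi else - (2 * pi)).
    apply: IVT_between => //.
    have := angle_of_lt (r s0) (a s0) (b s0); have := angle_of_lt (r s1) (a s1) (b s1).
    rewrite /D gs0 gs1 speed_lo speed_hi mulr0 addr0.
    have pi0 := pi_gt0 R.
    move=> /andP[? ?] /andP[? ?].
    rewrite /between; case: ifPn => kk.
      have : (1 : R) <= k%:~R by rewrite ler1z.
      by move=> ?; apply/orP; left; apply/andP; split; nra.
    have : k%:~R <= (-1 : R).
      have : k < 0 by rewrite lt_neqAle k0 leNgt.
      by rewrite -lezD1 -(lerz0 R) intrD mulr1z; lra.
    by move=> ?; apply/orP; right; apply/andP; split; nra.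
  exists s => //.
  have [ra1 rb1] := angle_ofP (r0 s bs) (ab s bs) (ra s bs).
  rewrite (twist_angle _ nn ff fn ra1 rb1) -/(D s) Ds.
  have -> : cos (be + (if 0 < k then 2 * pi else - (2 * pi))) = dot e' f.
    rewrite -cosb -[2 * pi]/(2%:R * pi) mulr_natl.
    by case: ifP => _; [rewrite cosD2pi|rewrite -(cosD2pi (be - _)) subrK].
  have -> : sin (be + (if 0 < k then 2 * pi else - (2 * pi))) =
      dot e' (cross (axis c) f).
    rewrite -sinb -[2 * pi]/(2%:R * pi) mulr_natl.
    by case: ifP => _; [rewrite sinD2pi|rewrite -(sinD2pi (be - _)) subrK].
  rewrite /meridian_pt -/(r s) {3}(frame_decomp e' nn ff fn) en' scale0r add0r.
  by rewrite scalerDr !scalerA addrA.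
have [t1 bt1 gt1] := reach e1 ee1 en1.
have [t2 bt2 gt2] := reach e2 ee2 en2.
have cG := @wcont_twist c k%:~R g cg (axis c'').
have [h1 _] := out2 _ (gband _ bt1); have [_ h2] := out2 _ (gband _ bt2).
have [||s2 [s3 [lo2 hi3 sub]]] := @sub_crossing _ t2 t1 _ _ cG (lo_lt_hi c'').
- by move: h2; rewrite /ht -gt2 => /ltW.
- by move: h1; rewrite /ht -gt1 => /ltW; apply/le_trans/ltW/hi_lt.
exists s2, s3; split => // s /sub[? bs]; split => //.
by rewrite /band ht_twist //; apply/gband; exact: between_trans bs.
Qed.

End Band.
End Crossing.

(** * From circles to annuli *)

Section Thickening.
Variable R : realType.
Local Notation E := 'rV[R]_3.

Lemma near_all_in (T : eqType) (r : seq T) (F : set_system R) {FF : Filter F}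
    (P : T -> R -> Prop) :
  (forall t, t \in r -> \forall x \near F, P t x) ->
  \forall x \near F, forall t, t \in r -> P t x.
Proof.
elim: r => [_|s r IH Pr]; first by near=> x.
have Ps := Pr s (mem_head _ _).
have {}IH : \forall x \near F, forall t, t \in r -> P t x.
  by apply: IH => t tr; apply: Pr; rewrite inE tr orbT.
near=> x => t; rewrite inE => /orP[/eqP ->|]; first by near: x.
by move: t; near: x.
Unshelve. all: by end_near. Qed.

(** At the height of c the meridian through q passes through q; continuity in
    the height does the rest. *)
Lemma meridian_close (c c' : circle R) (q : E) : wf_circle c ->
  dot q q = 1 -> ht c q = height c ->
  exists e, [/\ dot e e = 1, dot e (axis c) = 0 & forall d, 0 < d ->
    \forall eps \near 0^'+, forall z, `|z - height c| <= eps ->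
      `|ht c' (meridian_pt c e z) - ht c' q| < d].
Proof.
case=> nn _ _ h1 qq hq; have a0 : 0 < Num.sqrt (1 - height c ^+ 2).
  by rewrite sqrtr_gt0 subr_gt0.
have a2 : Num.sqrt (1 - height c ^+ 2) ^+ 2 = 1 - height c ^+ 2.
  by rewrite sqr_sqrtr // subr_ge0 ltW.
pose e := (Num.sqrt (1 - height c ^+ 2))^-1 *: (q - height c *: axis c).
have mq : meridian_pt c e (height c) = q.
  by rewrite /meridian_pt scalerA divff ?gt_eqF // scale1r addrC subrK.
exists e; split.
- rewrite /e !dotE qq nn (dotC (axis c)) -/(ht c q) hq.
  transitivity ((1 - height c ^+ 2) / Num.sqrt (1 - height c ^+ 2) ^+ 2).
    by field; rewrite gt_eqF.
  by rewrite a2 divff // gt_eqF // subr_gt0.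
- by rewrite /e !dotE nn -/(ht c q) hq mulr1 subrr mulr0.
move=> d d0.
have cF : continuous (fun z => ht c' (meridian_pt c e z)).
  have -> : (fun z => ht c' (meridian_pt c e z)) = (fun z =>
      z * dot (axis c) (axis c') + Num.sqrt (1 - z ^+ 2) * dot e (axis c')).
    by apply/funext => z; rewrite /ht /meridian_pt !dotE.
  move=> z; apply: cvgD; apply: cvgM; try exact: cvg_cst; first exact: cvg_id.
  apply: (continuous_comp (f := fun z : R => 1 - z ^+ 2)); last exact: sqrt_continuous.
  apply: cvgB; first exact: cvg_cst.
  by apply: cvgM; exact: cvg_id.
have := cF (height c) => /cvgrPdist_lt/(_ _ d0); rewrite mq.
move=> /nbhs_ballP[r /= r0 rP]; near=> eps => z zeps.
rewrite distrC; apply: rP; rewrite /ball /= distrC.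
apply: le_lt_trans zeps _.
by near: eps; exact: nbhs_right_lt.
Unshelve. all: by end_near. Qed.

Lemma separates_sticks_out (c c' : circle R) : wf_circle c -> separates c c' ->
  \forall eps \near 0^'+, sticks_out eps c c'.
Proof.
move=> wf [q [q' [qq qq' hq hq' [out inn]]]].
have [e [ee en eP]] := meridian_close c' wf qq hq.
have [e' [ee' en' eP']] := meridian_close c' wf qq' hq'.
pose d := (ht c' q - height c') / 2; pose d' := (height c' - ht c' q') / 2.
have d0 : 0 < d by rewrite divr_gt0 // subr_gt0.
have d0' : 0 < d' by rewrite divr_gt0 // subr_gt0.
have N1 := eP _ d0; have N2 := eP' _ d0'.
near=> eps; exists e, e'; split => //.
have H1 : forall z, `|z - height c| <= eps ->
    `|ht c' (meridian_pt c e z) - ht c' q| < d by near: eps.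
have H2 : forall z, `|z - height c| <= eps ->
    `|ht c' (meridian_pt c e' z) - ht c' q'| < d' by near: eps.
have epsd : eps < d by near: eps; exact: nbhs_right_lt.
have epsd' : eps < d' by near: eps; exact: nbhs_right_lt.
move=> z zeps; have := H2 z zeps; have := H1 z zeps.
rewrite !ltr_norml => /andP[h1 _] /andP[_ h2].
by split; rewrite /d /d' in h1 h2 epsd epsd'; lra.
Unshelve. all: by end_near. Qed.

Variable T : eqType.
Implicit Types (s t : seq T) (L : seq (seq T)) (C : seq T -> circle R).

(** The half-width eps is so small that the annuli inherit the crossing pattern
    of the circles, and that the north pole keeps away from all of them. *)
Record thick L C (eps : R) : Prop := Thick {
  thick_gt0 : 0 < eps;
  thick_sq : forall s, s \in L -> forall z, `|z - height (C s)| <= eps -> z ^+ 2 < 1;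
  thick_disj : forall s t, s \in L -> t \in L -> s != t -> ~~ adj s t ->
    forall x, dot x x = 1 -> band eps (C s) x -> ~~ band eps (C t) x;
  thick_out : forall s t, s \in L -> t \in L -> adj s t ->
    sticks_out eps (C s) (C t);
  thick_north : forall s, s \in L -> 2 * eps < `|ht (C s) (north R) - height (C s)|
}.

Lemma thick_exists L C : config L C -> exists eps, thick L C eps.
Proof.
case=> _ _ cwf cnorth _ cadj capart.
have N1 : \forall eps \near (0 : R)^'+, forall s, s \in L ->
    forall z, `|z - height (C s)| <= eps -> z ^+ 2 < 1.
  apply: near_all_in => s sL; have [_ _ _ h1] := cwf s sL.
  have {}h1 : `|height (C s)| < 1.
    by rewrite -(@ltr_pXn2r _ 2) ?nnegrE // expr1n real_normK ?num_real.
  near=> eps => z zeps.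
  rewrite -(real_normK (num_real z)) -(expr1n _ 2) ltr_pXn2r ?nnegrE //.
  have : eps < 1 - `|height (C s)| by near: eps; apply: nbhs_right_lt; rewrite subr_gt0.
  have := ler_distD (height (C s)) z 0; rewrite !subr0; lra.
have N2 : \forall eps \near (0 : R)^'+, forall s, s \in L -> forall t, t \in L ->
    s != t -> ~~ adj s t -> forall x, dot x x = 1 -> band eps (C s) x -> ~~ band eps (C t) x.
  apply: near_all_in => s sL; apply: near_all_in => t tL.
  case: (boolP ((s != t) && ~~ adj s t)) => [/andP[st nst]|nst]; last first.
    by near=> eps => st ast; rewrite st ast in nst.
  have [d d0 dP] := capart s t sL tL st nst.
  near=> eps => _ _ x xx; rewrite /band => h1; apply/negP => h2.
  have := dP x xx.
  have : eps < d / 2 by near: eps; apply: nbhs_right_lt; rewrite divr_gt0.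
  lra.
have N3 : \forall eps \near (0 : R)^'+, forall s, s \in L -> forall t, t \in L ->
    adj s t -> sticks_out eps (C s) (C t).
  apply: near_all_in => s sL; apply: near_all_in => t tL.
  case: (boolP (adj s t)) => [st|nst]; last by near=> eps.
  have := separates_sticks_out (cwf s sL) (cadj s t sL tL st).
  by apply: filterS => eps.
have N4 : \forall eps \near (0 : R)^'+, forall s, s \in L ->
    2 * eps < `|ht (C s) (north R) - height (C s)|.
  apply: near_all_in => s sL; have h := cnorth s sL.
  near=> eps.
  have : eps < `|ht (C s) (north R) - height (C s)| / 2.
    by near: eps; apply: nbhs_right_lt; rewrite divr_gt0 // normr_gt0 subr_eq0.
  lra.
near (0 : R)^'+ => eps; exists eps; split.
- by near: eps; exact: nbhs_right_gt.
- by near: eps.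
- by move=> s t sL tL; move: s sL t tL; near: eps; exact: N2.
- by move=> s t sL tL; move: s sL t tL; near: eps; exact: N3.
- by near: eps.
Unshelve. all: by end_near. Qed.

End Thickening.

(** * Shortest words in right-angled Artin groups *)

Section IntegerPowers.
Local Open Scope group_scope.
Variable G : groupType.
Implicit Types (x y : G) (k l : int).

(** Powers with integer exponents, to merge two syllables of a word on the same
    generator. *)
Definition zexp x k : G := match k with Posz n => x ^+ n | Negz n => x ^- n.+1 end.

Lemma zexpS x k : zexp x (k + 1)%R = zexp x k * x.
Proof.
case: k => [n|[|n]].
- by rewrite -[(n%:Z + 1)%R]/((n + 1)%N%:Z) addn1 /= expgSr.
- by rewrite /= expg1 mulVg.
- have -> : (Negz n.+1 + 1)%R = Negz n by rewrite !NegzE -addn1 PoszD opprD addrK.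
  by rewrite /= [x ^+ n.+2]expgS invgM mulgVK.
Qed.

Lemma zexpD x k l : zexp x (k + l)%R = zexp x k * zexp x l.
Proof.
have zexpP (z : int) : zexp x (z - 1)%R = zexp x z * x^-1.
  by rewrite -[in RHS](subrK 1 z)%R zexpS mulgK.
elim/int_rect: l => [|n IH|n IH].
- by rewrite addr0 mulg1.
- by rewrite -addn1 PoszD addrA !zexpS IH mulgA.
- by rewrite -addn1 PoszD opprD addrA !zexpP IH mulgA.
Qed.

Lemma commute_zexp x y k l : commute x y -> commute (zexp x k) (zexp y l).
Proof.
have cz z t m : commute z t -> commute z (zexp t m).
  by move=> zt; case: m => m /=; [|apply: commuteV]; exact: commuteX.
by move=> xy; apply/cz/commute_sym/cz/commute_sym.
Qed.

End IntegerPowers.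

Section Syllables.
Variables (V : finType) (e : rel V).
Local Open Scope group_scope.
Local Notation G := (raag e).

Definition raag_gen (v : V) : G := raag_of_word e [:: (v, true)].

Definition syl_val (s : seq (V * int)) : G :=
  foldr (fun p g => zexp (raag_gen p.1) p.2 * g) 1 s.

Lemma syl_val_cat s t : syl_val (s ++ t) = syl_val s * syl_val t.
Proof. by elim: s => [|p s IH] /=; rewrite ?mul1g // IH mulgA. Qed.

Lemma gen_inv v : raag_of_word e [:: (v, false)] = (raag_gen v)^-1.
Proof.
apply: (mulgI (raag_gen v)); rewrite mulgV.
rewrite -[LHS]/(raag_mul _ _) raag_mulE.
by apply/raag_of_wordP; exact: (raag_eqv_cancel e v true).
Qed.

Lemma raag_of_word_cat s t :
  raag_of_word e (s ++ t) = raag_of_word e s * raag_of_word e t.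
Proof. by rewrite -raag_mulE. Qed.

Lemma gen_commute v w : ~~ e v w -> commute (raag_gen v) (raag_gen w).
Proof.
move=> vw; have : (raag_gen v)^-1 * (raag_gen w)^-1 * raag_gen v * raag_gen w = 1.
  rewrite -!gen_inv /raag_gen -(raag_of_word_cat [:: _]) /=.
  rewrite -(raag_of_word_cat [:: _; _]) /= -(raag_of_word_cat [:: _; _; _]).
  by apply/raag_of_wordP; exact: raag_eqv_comm.
move=> h; rewrite /commute.
by apply/esym/(mulgI (raag_gen w)^-1)/(mulgI (raag_gen v)^-1); rewrite mulKg mulVg !mulgA h.
Qed.

Lemma syl_val_surj g : exists s, syl_val s = g.
Proof.
rewrite -(raag_of_wordK g); elim: (repr g) => [|[v b] w [s sw]].
  by exists [::].
exists ((v, if b then 1%R else (-1)%R) :: s).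
rewrite -[(v, b) :: w]cat1s raag_of_word_cat /= sw; congr (_ * _).
by case: b => //=; rewrite gen_inv expg1.
Qed.

(** Minimality of the number of syllables replaces normal forms in the group:
    it passes to factors and forbids the merging of two syllables, which is all
    that the dynamics needs. *)
Definition syl_minimal (s : seq (V * int)) : Prop :=
  forall t, syl_val t = syl_val s -> (size s <= size t)%N.

Lemma minimal_exists g : exists2 s, syl_val s = g & syl_minimal s.
Proof.
have ex : exists n, `[< exists2 s, syl_val s = g & size s = n >].
  by have [s sg] := syl_val_surj g; exists (size s); apply/asboolP; exists s.
case: (ex_minnP ex) => n /asboolP[s sg sn] min_n; exists s => // t ts.
by rewrite sn; apply: min_n; apply/asboolP; exists t; rewrite // ts.
Qed.

Lemma minimal_factor a b c : syl_minimal (a ++ b ++ c) -> syl_minimal b.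
Proof.
move=> min t tb; have := min (a ++ t ++ c).
rewrite !syl_val_cat tb => /(_ erefl).
by rewrite !size_cat leq_add2l leq_add2r.
Qed.

Lemma minimal_neq0 a v k c : syl_minimal (a ++ (v, k) :: c) -> k != 0%R.
Proof.
move=> min; apply/eqP => k0; have := min (a ++ c).
rewrite !syl_val_cat k0 /= mul1g => /(_ erefl).
by rewrite !size_cat /= leq_add2l ltnn.
Qed.

(** Otherwise x commutes with everything between its two occurrences and the
    two syllables merge into one. *)
Lemma minimal_between a x k m l c :
  syl_minimal (a ++ (x, k) :: m ++ (x, l) :: c) ->
  exists2 y, y \in unzip1 m & e y x.
Proof.
move=> min; apply: contrapT => nex.
have cm : commute (syl_val m) (zexp (raag_gen x) k).
  elim: m {min} nex => [_|[y j] m IH nex] /=; first exact/commute_sym/commute1.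
  apply/commute_sym/commuteM; apply/commute_sym; last first.
    by apply: IH => -[z zm zx]; apply: nex; exists z => //; rewrite inE zm orbT.
  apply/commute_zexp/gen_commute/negP => yx.
  by apply: nex; exists y => //; rewrite inE eqxx.
have := min (a ++ m ++ (x, k + l)%R :: c).
rewrite !(syl_val_cat, zexpD) /= !syl_val_cat /= zexpD !mulgA -!(mulgA (syl_val a)) cm.
move=> /(_ erefl); rewrite !size_cat /= !size_cat /= leq_add2l.
by rewrite addnS ltnn.
Qed.

End Syllables.

(** * The action of the group and ping-pong on curves *)

Section Action.
Variables (R : realType) (V : finType) (e : rel V).
Hypotheses (e_sym : symmetric e) (e_irr : irreflexive e).
Variables (L : seq (seq V)) (C : seq V -> circle R) (eps : R).
Hypotheses (LC : config L C) (tLC : thick L C eps).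
Local Notation E := 'rV[R]_3.
Local Notation unit x := (dot x x = 1).

(** The nodes at which the generator of v twists are the paths of the graph
    ending at v, listed backwards: the parent of such a node is a path ending
    at a neighbour of v. *)
Definition labelled v (s : seq V) : bool :=
  if s is x :: _ then (x == v) && sorted e s else false.

Definition nodes v := [seq s <- undup L | labelled v s].

Lemma nodesP v s : s \in nodes v ->
  exists t, [/\ s = v :: t, sorted e s & s \in L].
Proof.
rewrite mem_filter mem_undup => /andP[]; case: s => //= x t /andP[/eqP -> ?] ?.
by exists t.
Qed.

Lemma nodes_L v s : s \in nodes v -> s \in L.
Proof. by case/nodesP => t []. Qed.

Lemma uniq_nodes v : uniq (nodes v).
Proof. by rewrite filter_uniq // undup_uniq. Qed.

Lemma axis_unit s : s \in L -> unit (axis (C s)).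
Proof. by case/(config_wf LC). Qed.

(** Adjacent nodes are consecutive on a path of the graph, hence carry adjacent
    labels. For v = w this shows that the annuli on which one generator acts
    are pairwise disjoint. *)
Lemma nodes_adj v w s t : s \in nodes v -> t \in nodes w -> adj s t -> e v w.
Proof.
move=> /nodesP[s' [-> ss _]] /nodesP[t' [-> st _]] /orP[]/andP[_ /= /eqP h].
  by move: ss; rewrite h /= => /andP[].
by move: st; rewrite h /= e_sym => /andP[].
Qed.

Lemma band_adj s t x : s \in L -> t \in L -> s != t -> unit x ->
  band eps (C s) x -> band eps (C t) x -> adj s t.
Proof.
move=> sL tL st xx bs bt; apply: contraLR bt => nst.
exact: (thick_disj tLC sL tL st nst xx).
Qed.

Lemma nodes_band v w s t x : ~~ e v w -> s \in nodes v -> t \in nodes w -> unit x ->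
  band eps (C s) x -> band eps (C t) x -> s = t.
Proof.
move=> vw sv tw xx bs bt; apply/eqP/negPn/negP => st.
case/negP: vw; apply: (nodes_adj sv tw).
exact: (band_adj (nodes_L sv) (nodes_L tw) st xx bs bt).
Qed.

(** Composing the twists, rather than distinguishing the cases according to the
    annulus that contains the point, makes continuity immediate. *)
Definition twist_seq (r : seq (seq V)) (t : R) (x : E) : E :=
  foldr (fun s y => twist eps (C s) t y) x r.

Definition flow v := twist_seq (nodes v).

Let eps0 : 0 < eps := thick_gt0 tLC.

Lemma twist_seq_out r t x : (forall s, s \in r -> ~~ band eps (C s) x) ->
  twist_seq r t x = x.
Proof.
elim: r => //= s r IH out.
rewrite IH; last by move=> u ur; apply: out; rewrite inE ur orbT.
by rewrite twist_out //; apply: out; rewrite inE eqxx.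
Qed.

Lemma flow_out v t x : (forall s, s \in nodes v -> ~~ band eps (C s) x) ->
  flow v t x = x.
Proof. exact: twist_seq_out. Qed.

Lemma unit_twist s t x : s \in L -> dot (twist eps (C s) t x) (twist eps (C s) t x) = dot x x.
Proof. by move=> sL; apply: dot_twist; exact: axis_unit. Qed.

Lemma band_twist s t x : s \in L -> band eps (C s) (twist eps (C s) t x) = band eps (C s) x.
Proof. by move=> sL; rewrite /band ht_twist //; exact: axis_unit. Qed.

Lemma flow_in v t s x : s \in nodes v -> unit x -> band eps (C s) x ->
  flow v t x = twist eps (C s) t x.
Proof.
move=> sv xx bs; have sL := nodes_L sv.
have out y u : unit y -> band eps (C s) y -> u \in nodes v -> u != s ->
    ~~ band eps (C u) y.
  move=> yy bsy uv us; apply/negP => bu; case/eqP: us.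
  by apply: (nodes_band _ uv sv yy bu bsy); rewrite e_irr.
have := uniq_nodes v; rewrite /flow; move: out.
case/splitPr: (nodes v) / sv => r1 r2 out.
rewrite cat_uniq /= negb_or => /and3P[_ /andP[sr1 _] /andP[sr2 _]].
rewrite /twist_seq foldr_cat /= -!/(twist_seq _ _ _).
rewrite (twist_seq_out (r := r2)) => [|u ur].
  apply: twist_seq_out => u ur; apply: out.
  - by rewrite unit_twist.
  - by rewrite band_twist.
  - by rewrite mem_cat ur.
  - by apply: contraNneq sr1 => <-.
apply: out => //; first by rewrite mem_cat inE ur !orbT.
by apply: contraNneq sr2 => <-.
Qed.

Lemma flowP v x : unit x ->
  (exists s, [/\ s \in nodes v, band eps (C s) x &
     forall t, flow v t x = twist eps (C s) t x]) \/
  ((forall s, s \in nodes v -> ~~ band eps (C s) x) /\ forall t, flow v t x = x).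
Proof.
move=> xx; have [/hasP[s sv bs]|/hasPn out] :=
    boolP (has (fun s => band eps (C s) x) (nodes v)).
  by left; exists s; split => // t; exact: flow_in.
by right; split => // t; exact: flow_out.
Qed.

Lemma dot_flow v t x : dot (flow v t x) (flow v t x) = dot x x.
Proof.
rewrite /flow; have : {subset nodes v <= L} by move=> s /nodes_L.
elim: (nodes v) => //= s r IH sub.
rewrite unit_twist; last by apply: sub; rewrite inE eqxx.
by apply: IH => u ur; apply: sub; rewrite inE ur orbT.
Qed.

Lemma wcont_flow v t (g : R -> E) : wcont g -> wcont (fun s => flow v t (g s)).
Proof.
move=> cg; rewrite /flow; elim: (nodes v) => //= s r IH.
exact: (@wcont_twist _ _ _ t (twist_seq r t \o g)).
Qed.

Lemma flow0 v x : flow v 0 x = x.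
Proof. by rewrite /flow; elim: (nodes v) => //= s r ->; rewrite twist0. Qed.

Lemma flowD v s t x : unit x -> flow v (s + t) x = flow v s (flow v t x).
Proof.
move=> xx; have [[u [uv bu ->]]|[_ nof]] := flowP v xx; last by rewrite !nof.
have uL := nodes_L uv.
rewrite (flow_in t uv xx bu) twistD ?axis_unit //.
by rewrite (flow_in s uv) ?unit_twist ?band_twist.
Qed.

(** The annuli for v and those for w are disjoint and each is preserved by the
    flow of its generator. *)
Lemma flow_comm v w s t x : ~~ e v w -> unit x ->
  flow v s (flow w t x) = flow w t (flow v s x).
Proof.
move=> vw xx; have [<-|vNw] := eqVneq v w; first by rewrite -!flowD // addrC.
wlog : v w s t vw vNw / exists u, u \in nodes v /\ band eps (C u) x.
  move=> wl; have [[u [uv bu _]]|[nv nof]] := flowP v xx; first by apply: wl => //; exists u.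
  have [[u [uw bu _]]|[_ nof']] := flowP w xx; last by rewrite !(nof, nof').
  by apply/esym/wl; rewrite 1?e_sym 1?eq_sym //; exists u.
move=> [u [uv bu]]; have uL := nodes_L uv.
have nw y : unit y -> band eps (C u) y -> flow w t y = y.
  move=> yy buy; apply: flow_out => z zw; apply/negP => bz.
  have uz := nodes_band vw uv zw yy buy bz.
  have [u' [uE _ _]] := nodesP uv; have [z' [zE _ _]] := nodesP zw.
  by move: uz; rewrite uE zE => -[/eqP]; rewrite (negPf vNw).
rewrite (nw x) // (flow_in s uv) // nw //; first by rewrite unit_twist.
by rewrite band_twist.
Qed.

Definition act (w : seq (V * bool)) (x : E) : E :=
  foldr (fun p y => flow p.1 (if p.2 then 1 else -1) y) x w.

Lemma act_cat w w' x : act (w ++ w') x = act w (act w' x).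
Proof. by rewrite /act foldr_cat. Qed.

Lemma dot_act w x : dot (act w x) (act w x) = dot x x.
Proof. by elim: w => //= p w IH; rewrite dot_flow. Qed.

(** The action of words respects the defining relations, whence an action of
    the group on the sphere. *)
Lemma act_eqv w w' : raag_eqv e w w' -> forall x, unit x -> act w x = act w' x.
Proof.
elim=> {w w'} [//|s t _ IH|t s u _ IH1 _ IH2|s s' t t' _ IH1 _ IH2|v b|v w vw] x xx.
- by rewrite IH.
- by rewrite IH1 // IH2.
- by rewrite !act_cat IH2 // IH1 // dot_act.
- rewrite /= -flowD //; case: b; rewrite /= ?subrr ?addNr; exact: flow0.
- have ux y (u : V) r : unit y -> unit (flow u r y) by move=> <-; exact: dot_flow.
  rewrite /= [flow w _ (flow v _ _)]flow_comm ?ux //; last by rewrite e_sym.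
  by rewrite -flowD ?ux // addNr flow0 -flowD // addNr flow0.
Qed.

Definition phi (g : raag e) : E -> E := act (repr g).

Lemma phi_of_word w x : unit x -> phi (raag_of_word e w) x = act w x.
Proof. by move=> xx; apply: act_eqv => //; exact: repr_raag_of_word. Qed.

Lemma dot_phi g x : dot (phi g x) (phi g x) = dot x x.
Proof. exact: dot_act. Qed.

Lemma phi1 x : unit x -> phi 1%g x = x.
Proof. exact: phi_of_word. Qed.

Lemma phiM g h x : unit x -> phi (g * h)%g x = phi g (phi h x).
Proof.
move=> xx; rewrite -[in LHS](raag_of_wordK g) -[in LHS](raag_of_wordK h).
by rewrite -raag_of_word_cat phi_of_word // act_cat.
Qed.

Lemma phiV g x : unit x -> phi g^-1%g (phi g x) = x.
Proof. by move=> xx; rewrite -phiM // mulVg phi1. Qed.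

Lemma phi_raag_gen v x : unit x -> phi (raag_gen e v) x = flow v 1 x.
Proof. exact: phi_of_word. Qed.

Lemma phi_zexp v (k : int) x : unit x -> phi (zexp (raag_gen e v) k) x = flow v k%:~R x.
Proof.
have nat n y : unit y -> phi (raag_gen e v ^+ n)%g y = flow v n%:R y.
  elim: n y => [|n IH] y yy; first by rewrite expg0 phi1 // flow0.
  by rewrite expgS phiM // IH // phi_raag_gen ?dot_flow // -flowD // mulrS.
move=> xx; case: k => [n|n]; first exact: nat.
set y := flow v (Negz n)%:~R x.
have yy : unit y by rewrite dot_flow.
have xE : x = phi (raag_gen e v ^+ n.+1)%g y.
  by rewrite nat // /y -flowD // NegzE mulrNz addrN flow0.
by rewrite /= [X in phi _ X]xE phiV.
Qed.

Definition act_syl (s : seq (V * int)) (x : E) : E :=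
  foldr (fun p y => flow p.1 p.2%:~R y) x s.

Lemma act_syl_cat w w' x : act_syl (w ++ w') x = act_syl w (act_syl w' x).
Proof. by rewrite /act_syl foldr_cat. Qed.

Lemma dot_act_syl w x : dot (act_syl w x) (act_syl w x) = dot x x.
Proof. by elim: w => //= p w IH; rewrite dot_flow. Qed.

Lemma wcont_act_syl w (g : R -> E) : wcont g -> wcont (fun s => act_syl w (g s)).
Proof. by move=> cg; elim: w => //= p w IH; exact: wcont_flow. Qed.

Lemma phi_syl s x : unit x -> phi (syl_val e s) x = act_syl s x.
Proof.
move=> xx; elim: s => [|p s IH] /=; first exact: phi1.
by rewrite phiM // IH phi_zexp // dot_act_syl.
Qed.

Hypothesis HL : forall s : seq V, uniq s -> s \in L.

Lemma crosses_eq (c c' : circle R) (g g' : R -> E) :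
  (forall s, band eps c (g s) -> band eps c' (g s) -> g' s = g s) ->
  crosses eps c c' g -> crosses eps c c' g'.
Proof.
move=> gg' [s0 [s1 [h0 h1 H]]].
have E s : between s0 s1 s -> g' s = g s.
  by move=> /H[lh b]; apply: gg' => //; exact: lo_hi_band.
have b0 : between s0 s1 s0 by rewrite /between lexx /=; case: leP => // /ltW ->.
have b1 : between s0 s1 s1 by rewrite /between lexx !andbT; case: leP => // /ltW ->.
exists s0, s1; rewrite !E //; split => // s bs; rewrite E //; exact: H.
Qed.

(** A tree has no triangle: an annulus meeting both the one of x :: anc and
    that of its parent anc is one of these two, and neither carries the label
    v. *)
Lemma flow_fix v t x anc y : v != x -> v \notin anc -> x :: anc \in L ->
  unit y -> band eps (C (x :: anc)) y -> band eps (C anc) y -> flow v t y = y.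
Proof.
move=> vx vanc sL yy b1 b2; apply: flow_out => u uv; apply/negP => bu.
have [u' [uE _ uL]] := nodesP uv; have aL : anc \in L := config_behead LC sL.
have us : u != x :: anc by rewrite uE eqseq_cons negb_and vx.
have ua : u != anc by apply: contraNneq vanc => <-; rewrite uE inE eqxx.
have /orP[/andP[_ /eqP h1]|/andP[_ /eqP h1]] := band_adj uL sL us yy bu b1; last first.
  by move: ua; rewrite -h1 /= eqxx.
have /orP[/andP[_ /eqP h2]|/andP[_ /eqP h2]] := band_adj uL aL ua yy bu b2.
  by have /eqP := congr1 size (etrans (esym h1) h2); rewrite /= eqn_leq ltnn.
have /eqP := congr1 (fun r => size (behead r)) h2.
rewrite h1 size_behead size_behead /=.
by rewrite ltn_eqF // (leq_ltn_trans (leq_pred _)) // ltnS leq_pred.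
Qed.

Lemma act_fix W x anc y : x \notin unzip1 W ->
  (forall v, v \in unzip1 W -> v \notin anc) -> x :: anc \in L ->
  unit y -> band eps (C (x :: anc)) y -> band eps (C anc) y -> act_syl W y = y.
Proof.
move=> xW Wanc sL yy b1 b2; elim: W xW Wanc => //= p W IH.
rewrite inE negb_or => /andP[xp xW] Wanc; rewrite IH //; last first.
  by move=> v vW; apply: Wanc; rewrite inE vW orbT.
by apply: flow_fix b1 b2 => //; [rewrite eq_sym|apply: Wanc; rewrite inE eqxx].
Qed.

Lemma last_split (W : seq (V * int)) x : x \in unzip1 W -> exists W' (k : int) m,
  W = W' ++ (x, k) :: m /\ x \notin unzip1 m.
Proof.
elim: W => //= p W IH; rewrite inE.
case: (boolP (x \in unzip1 W)) => [/IH[W' [k [m [-> xm]]]] _|xW].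
  by exists (p :: W'), k, m.
by case: p => y k; rewrite orbF /= => /eqP <-; exists [::], k, W.
Qed.

Lemma unzip1_cat (a b : seq (V * int)) : unzip1 (a ++ b) = unzip1 a ++ unzip1 b.
Proof. exact: map_cat. Qed.

(** On the annulus of the node s, which ends at x, the flow of x is the twist
    about s. *)
Lemma syllable_crosses x anc t u (k : int) (g : R -> E) :
  let s := x :: anc in s \in L -> sorted e s -> t \in L -> u \in L ->
  adj s t -> adj s u -> k != 0 -> wcont g -> (forall r, unit (g r)) ->
  crosses eps (C s) (C t) g ->
  crosses eps (C u) (C s) (fun r => flow x k%:~R (g r)).
Proof.
move=> s sL ss tL uL st su k0 cg gg cr.
have sx : s \in nodes x by rewrite mem_filter mem_undup sL andbT /= eqxx; exact: ss.
have := twist_crosses eps0 (axis_unit sL) (thick_sq tLC sL)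
  (thick_out tLC sL tL st) (thick_out tLC sL uL su) k0 cg gg cr.
apply: crosses_eq => r _; rewrite band_twist // => bs.
exact: flow_in.
Qed.

(** Let s = x :: anc. The letters on the branch anc do not occur in W. Reading
    W from the right, the first syllable of x winds the curve around the
    annulus of s. Between two syllables of x some letter y adjacent to x
    occurs; the subword between them avoids s, so by induction on the length it
    carries the curve, which crosses the annulus of y :: s inside that of s, to
    one that crosses the annulus of s inside that of y :: s. There it is wound
    again by the next syllable of x. After the last syllable the curve crosses
    the annulus of anc inside that of s, and the remaining letters do not act
    on this intersection. As each recursive call removes a letter, only
    duplicate-free branches occur. *)
Lemma pingpong n W x anc (g : R -> E) : (size W < n)%N -> syl_minimal e W ->
  x \in unzip1 W -> (forall v, v \in unzip1 W -> v \notin anc) ->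
  uniq anc -> sorted e (x :: anc) -> wcont g -> (forall r, unit (g r)) ->
  crosses eps (C (x :: anc)) (C anc) g ->
  crosses eps (C anc) (C (x :: anc)) (fun r => act_syl W (g r)).
Proof.
elim: n W x anc g => // n IH W x anc g Wn minW xW Wanc uanc ss cg gg cr.
have us : uniq (x :: anc) by rewrite /= uanc Wanc.
have sL : x :: anc \in L := HL us.
have aL : anc \in L := HL uanc.
have asa : adj (x :: anc) anc by rewrite /adj /child_of /= eqxx.
have [W' [k [m [WE xm]]]] := last_split xW.
have Wanc' v : v \in unzip1 W' -> v \notin anc.
  by move=> vW; apply: Wanc; rewrite WE unzip1_cat mem_cat vW.
have manc v : v \in unzip1 m -> v \notin anc.
  by move=> vm; apply: Wanc; rewrite WE unzip1_cat mem_cat /= inE vm !orbT.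
have k0 : k != 0 by move: minW; rewrite WE; exact: minimal_neq0.
pose g1 r := flow x k%:~R (act_syl m (g r)).
have cg1 : wcont g1 by apply: wcont_flow; exact: wcont_act_syl.
have gg1 r : unit (g1 r) by rewrite /g1 dot_flow dot_act_syl.
(* Once wound around s, the curve crosses the annuli of all neighbours of s. *)
have wound1 u : u \in L -> adj (x :: anc) u -> crosses eps (C u) (C (x :: anc)) g1.
  move=> uL su; apply: (syllable_crosses sL ss aL uL asa su k0).
  - exact: wcont_act_syl.
  - by move=> r; rewrite dot_act_syl.
  - by apply: crosses_eq cr => r b1 b2; exact: act_fix b1 b2.
suff : crosses eps (C anc) (C (x :: anc)) (fun r => act_syl W' (g1 r)).
  by rewrite (_ : (fun r => act_syl W (g r)) = (fun r => act_syl W' (g1 r))) // WE;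
    apply/funext => r; rewrite act_syl_cat.
have W'n : (size W' <= n)%N.
  by move: Wn; rewrite WE size_cat /= addnS ltnS => /ltnW; apply: leq_trans; exact: leq_addr.
move: minW; rewrite WE => {WE Wn xm manc k0 cr cg gg}.
have [N W'N] : exists N, (size W' <= N)%N by exists (size W').
(* Induction on the part of the word on the left of the syllable of x read
    last. *)
elim: N W' k m W'n Wanc' W'N g1 cg1 gg1 wound1 => {g}
    [|N IHN] W' k m W'n Wanc' W'N g cg gg wound minW.
  by move: W'N; rewrite leqn0 => /nilP -> /=; apply: wound; rewrite // adjC.
case: (boolP (x \in unzip1 W')) => [xW'|xW']; last first.
  have aa : adj (x :: anc) anc by [].
  by apply: crosses_eq (wound _ aL aa) => r b1 b2; exact: act_fix b2 b1.
have [W'' [k' [m' [W'E xm']]]] := last_split xW'.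
have W''anc v : v \in unzip1 W'' -> v \notin anc.
  by move=> vW; apply: Wanc'; rewrite W'E unzip1_cat mem_cat vW.
have m'anc v : v \in unzip1 m' -> v \notin x :: anc.
  move=> vm; rewrite inE negb_or (memPn xm') //=.
  by apply: Wanc'; rewrite W'E unzip1_cat mem_cat /= inE vm !orbT.
have sizeE : size W' = (size W'' + size m').+1.
  by rewrite W'E size_cat /= addnS.
have minW' : syl_minimal e (W'' ++ (x, k') :: m' ++ (x, k) :: m).
  by move: minW; rewrite W'E -catA.
have k'0 : k' != 0 := minimal_neq0 minW'.
have [y ym' yx] := minimal_between minW'.
have uy : uniq (y :: x :: anc) by rewrite cons_uniq us (m'anc y ym').
have yL := HL uy.
have ay : adj (x :: anc) (y :: x :: anc) by rewrite /adj /child_of /= eqxx orbT.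
have cr' : crosses eps (C (x :: anc)) (C (y :: x :: anc)) (fun r => act_syl m' (g r)).
  apply: IH => //.
  - by apply: leq_trans W'n; rewrite sizeE ltnS leq_addl.
  - by apply: (@minimal_factor _ _ (W'' ++ [:: (x, k')]) _ ((x, k) :: m)); rewrite -catA.
  - by rewrite /= yx.
  - exact: wound.
rewrite W'E.
have -> : (fun r => act_syl (W'' ++ (x, k') :: m') (g r)) =
    (fun r => act_syl W'' (flow x k'%:~R (act_syl m' (g r)))).
  by apply/funext => r; rewrite act_syl_cat.
apply: (IHN W'' k' (m' ++ (x, k) :: m)) => //.
- by apply: leq_trans W'n; rewrite sizeE ltnW // ltnS leq_addr.
- by move: W'N; rewrite sizeE ltnS; apply: leq_trans; exact: leq_addr.
- by apply: wcont_flow; exact: wcont_act_syl.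
- by move=> r; rewrite dot_flow dot_act_syl.
- move=> u uL su; apply: (syllable_crosses sL ss yL uL ay su k'0) cr'.
  + exact: wcont_act_syl.
  + by move=> r; rewrite dot_act_syl.
Qed.

End Action.

(** * Twists as Hamiltonian flows *)

Section Triple.

Lemma det_mx22 (R : comRingType) (M : 'M[R]_2) :
  \det M = M 0 0 * M 1 1 - M 0 1 * M 1 0.
Proof.
rewrite (expand_det_row _ 0) !big_ord_recl big_ord0 /cofactor !det_mx11 !mxE /=.
have -> : lift 0 0 = 1 :> 'I_2 by apply/val_inj.
have -> : lift 1 0 = 0 :> 'I_2 by apply/val_inj.
by rewrite /= expr0 expr1; ring.
Qed.

Variable R : realType.
Local Notation E := 'rV[R]_3.

Lemma det_triple (a b c : E) :
  \det (\matrix_(i < 3) [:: a; b; c]`_i) = dot a (cross b c).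
Proof.
rewrite (expand_det_row _ 0) !big_ord_recl big_ord0 /cofactor !det_mx22 !mxE /=.
have -> : lift ord0 ord0 = 1 :> 'I_2 by apply/val_inj.
have -> : lift ord0 ord0 = 1 :> 'I_3 by apply/val_inj.
have -> : lift ord0 1 = 2%:R :> 'I_3 by apply/val_inj.
have -> : lift 1 0 = 0 :> 'I_3 by apply/val_inj.
have -> : lift 1 1 = 2%:R :> 'I_3 by apply/val_inj.
have -> : lift 2%:R 0 = 0 :> 'I_3 by apply/val_inj.
have -> : lift 2%:R 1 = 1 :> 'I_3 by apply/val_inj.
have -> : ord0 = 0 :> 'I_3 by apply/val_inj.
by rewrite dot3E !crossE /bump /= !addn0 add0n /= !addnE /=; ring.
Qed.

(** With the area form det(x, ., .), the field n x x is therefore the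
    Hamiltonian field of the height x |-> <n, x>. *)
Lemma triple_tangent (n x u : E) : dot x x = 1 -> dot x u = 0 ->
  dot x (cross (cross n x) u) = dot n u.
Proof.
move=> xx xu.
have -> : dot x (cross (cross n x) u) = dot n u * dot x x - dot x n * dot x u.
  by rewrite !dot3E !crossE; ring.
by rewrite xx xu; ring.
Qed.

Lemma crossDl (n m x : E) : cross (n + m) x = cross n x + cross m x.
Proof. by apply: rV3P; rewrite !(crossE, mxE); ring. Qed.

Lemma crossZl a (n x : E) : cross (a *: n) x = a *: cross n x.
Proof. by apply: rV3P; rewrite !(crossE, mxE); ring. Qed.

End Triple.

Section HamiltonianFlow.
Variables (R : realType) (V : finType) (e : rel V).
Hypotheses (e_sym : symmetric e) (e_irr : irreflexive e).
Variables (L : seq (seq V)) (C : seq V -> circle R) (eps : R).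
Hypotheses (LC : config L C) (tLC : thick L C eps).
Local Notation E := 'rV[R]_3.
Local Notation unit x := (dot x x = 1).
Let eps0 : 0 < eps := thick_gt0 tLC.
Local Notation flow := (flow e L C eps).
Local Notation nodes := (nodes e L).
Local Notation act := (act e L C eps).

(** The Hamiltonian of the twist: a primitive of its angular speed, as a
    function of the height. It is locally constant off the annulus. *)
Definition potential (c : circle R) (z : R) : R :=
  12 * pi * eps * step ((z - lo eps c) / (2 * eps)).

Lemma lo_affineE (c : circle R) (z : R) :
  (z - lo eps c) / (2 * eps) = (2 * eps)^-1 * z + - (lo eps c / (2 * eps)).
Proof. by rewrite mulrBl mulrC. Qed.

Lemma is_derive_potential c z : is_derive z (1 : R) (potential c) (speed eps c z).
Proof.
have -> : potential c = (12 * pi * eps) *: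
    (fun z => step ((2 * eps)^-1 * z + - (lo eps c / (2 * eps)))) :> (R -> R).
  by apply/funext => x; rewrite /potential lo_affineE.
have df := is_derive_affine (is_derive_step ((2 * eps)^-1 * z + - (lo eps c / (2 * eps)))).
apply: is_derive_eq; rewrite /speed lo_affineE /GRing.scale /=.
by field; rewrite gt_eqF.
Qed.

Lemma Dk_potential k c : Dk k (potential c).
Proof.
have -> : potential c = cst (12 * pi * eps) *
    (fun z => step ((2 * eps)^-1 * z + - (lo eps c / (2 * eps)))).
  by apply/funext => x; rewrite /potential lo_affineE.
by apply: DkM; [exact: Dk_cst|apply/Dk_affine/Dk_step].
Qed.

Definition ham v (x : E) : R := \sum_(s <- nodes v) potential (C s) (ht (C s) x).

Definition vfield v (x : E) : E :=
  \sum_(s <- nodes v) speed eps (C s) (ht (C s) x) *: cross (axis (C s)) x.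

Lemma dot_sumr (I : Type) (r : seq I) (F : I -> E) u :
  dot (\sum_(i <- r) F i) u = \sum_(i <- r) dot (F i) u.
Proof.
elim: r => [|i r IH]; last by rewrite !big_cons dotDl IH.
by rewrite !big_nil -[0 in LHS](scale0r 0) dotZl mul0r.
Qed.

Lemma vfield_tangent v x : dot x (vfield v x) = 0.
Proof.
by rewrite dotC dot_sumr big1 // => s _; rewrite dotZl dot_crossv mulr0.
Qed.

Lemma ham_gradient v (c : R -> E) x u : unit x -> dot x u = 0 -> c 0 = x ->
  is_derive (0 : R) (1 : R) c u ->
  is_derive (0 : R) (1 : R) (fun s => ham v (c s)) (dot x (cross (vfield v x) u)).
Proof.
move=> xx xu c0 dc.
have -> : dot x (cross (vfield v x) u) =
    \sum_(s <- nodes v) speed eps (C s) (ht (C s) x) * dot u (axis (C s)).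
  rewrite /vfield; elim: (nodes v) => [|s r IH].
    by rewrite !big_nil -(scale0r 0) crossZl dotZr mul0r.
  by rewrite !big_cons crossDl dotDr IH crossZl dotZr triple_tangent // dotC.
have H s : is_derive (0 : R) (1 : R) (fun t => potential (C s) (ht (C s) (c t)))
    (speed eps (C s) (ht (C s) x) * dot u (axis (C s))).
  have dh := is_derive_dot (axis (C s)) dc.
  rewrite -c0; have dp := is_derive_potential (C s) (ht (C s) (c 0)).
  exact: (@is_derive1_comp _ _ (fun t => ht (C s) (c t)) _ _ _ dp dh).
rewrite /ham; elim: (nodes v) => [|s r IH].
  rewrite big_nil; under eq_fun do rewrite big_nil.
  exact: is_derive_cst.
rewrite big_cons; under eq_fun do rewrite big_cons.
by apply: is_deriveD.
Qed.

Lemma vfield_in v s x : s \in nodes v -> unit x -> band eps (C s) x ->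
  vfield v x = speed eps (C s) (ht (C s) x) *: cross (axis (C s)) x.
Proof.
move=> sv xx bs; rewrite /vfield (bigD1_seq s) ?uniq_nodes //= big1_seq ?addr0 //.
move=> t /andP[ts tv]; rewrite speed_out ?scale0r //.
rewrite leNgt; apply: contraNN ts => /ltW bt; apply/eqP.
by apply: (nodes_band e_sym tLC _ tv sv xx bt bs); rewrite e_irr.
Qed.

Lemma vfield_out v x : (forall s, s \in nodes v -> ~~ band eps (C s) x) ->
  vfield v x = 0.
Proof.
move=> out; rewrite /vfield big1_seq // => s /andP[_ sv].
by rewrite speed_out ?scale0r //; move: (out s sv); rewrite /band -ltNge => /ltW.
Qed.

(** Stated along a reparametrization a of time, so that the same flow can be
    run forwards or backwards, and be switched on and off smoothly. *)
Lemma is_derive_flow v (a : R -> R) (t a' : R) x : unit x ->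
  is_derive t (1 : R) a a' ->
  is_derive t (1 : R) (fun s => flow v (a s) x) (a' *: vfield v (flow v (a t) x)).
Proof.
move=> xx da.
have [[s [sv bs fE]]|[out fE]] := flowP e_sym e_irr LC tLC v xx; last first.
  under eq_fun do rewrite fE.
  by rewrite fE vfield_out // scaler0; exact: is_derive_cst.
have sL := nodes_L sv.
rewrite (vfield_in sv) ?(dot_flow _ _ LC) //; last by rewrite fE (band_twist eps LC).
under eq_fun do rewrite fE.
rewrite fE ht_twist ?(axis_unit LC sL) //.
apply: is_derive_mx => u; rewrite /twist.
set sp := speed _ _ _; set n := axis _.
have dth : is_derive t (1 : R) (a * cst sp) (a' * sp).
  by apply: is_derive_eq; rewrite scaler0 add0r mulrC.
have -> : (fun r => dot (rotation n (a r * sp) x) u) =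
    dot x u *: (cos \o (a * cst sp)) + dot (cross n x) u *: (sin \o (a * cst sp)) +
    (dot n x * dot n u) *: (cst 1 - (cos \o (a * cst sp))).
  by apply/funext => r; rewrite !dotE !fctE /GRing.scale /=; ring.
have dcos := @is_derive1_comp _ _ _ _ _ _ (is_derive_cos _) dth.
have dsin := @is_derive1_comp _ _ _ _ _ _ (is_derive_sin _) dth.
apply: is_derive_eq.
rewrite cross_rotation ?(axis_unit LC sL) // !dotE !fctE /GRing.scale /=; ring.
Qed.

End HamiltonianFlow.

(** * Performing Hamiltonian flows one after the other *)

Section Concatenation.
Variables (R : realType) (V : finType) (e : rel V).
Hypotheses (e_sym : symmetric e) (e_irr : irreflexive e).
Variables (L : seq (seq V)) (C : seq V -> circle R) (eps : R).
Hypotheses (LC : config L C) (tLC : thick L C eps).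
Local Notation E := 'rV[R]_3.
Local Notation unit x := (dot x x = 1).
Local Notation flow := (flow e L C eps).
Local Notation act := (act e L C eps).
Local Notation ham := (ham e L C eps).
Local Notation vfield := (vfield e L C eps).

(** The height is linear and continuous on the whole space, so a smooth
    function of it extends smoothly off the sphere by the same formula. *)
Lemma Ck_height k (g : R -> R) (n : E) : (forall k, Dk k g) ->
  Ck k setT (fun p : E * R => g (dot p.1 n)).
Proof.
have cfst : continuous (fst : E * R -> E) by move=> q; exact: cvg_fst.
have dfst q : differentiable (fst : E * R -> E) q by exact: linear_differentiable.
move=> Dg; apply: (@Ck_comp _ _ k g (fun p : E * R => dot p.1 n)) => // [p|v].
  exact: (differentiable_comp (dfst p) (differentiable_dot n p.1)).
exists (dot v.1 n); apply/funext => p.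
have df : is_derive p v (fst : E * R -> E) v.1.
  apply: DeriveDef; first exact: diff_derivable.
  by rewrite deriveE // diff_lin.
by have [_ ->] := is_derive_dot n df.
Qed.

Lemma Ck_time k (g : R -> R) : (forall k, Dk k g) ->
  Ck k setT (fun p : E * R => g p.2).
Proof.
move=> Dg; apply: (@Ck_comp _ _ k g snd) => // [p|v].
  by apply: linear_differentiable => q; exact: cvg_snd.
exists v.2; apply/funext => p.
rewrite deriveE; last by apply: linear_differentiable => q; exact: cvg_snd.
by rewrite diff_lin // => q; exact: cvg_snd.
Qed.

Lemma Ck_ham k v : Ck k setT (fun p : E * R => ham v p.1).
Proof.
have -> : (fun p : E * R => ham v p.1) =
    \sum_(s <- nodes e L v) (fun p : E * R => potential eps (C s) (ht (C s) p.1)).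
  by apply/funext => p; rewrite fct_sumE.
apply: Ck_sum => s; apply: Ck_height => j; exact: Dk_potential.
Qed.

(** The map f is reached at time T by the flow F of a Hamiltonian H with field
    X, after which the field vanishes: another Hamiltonian may then be appended
    without losing smoothness. *)
Definition ham_path (f : E -> E) (T : R) := exists H X F,
  [/\ 0 <= T,
      forall k, Ck k setT (fun p : E * R => H p.1 p.2),
      forall x t, unit x -> dot x (X x t) = 0 /\
        forall (c : R -> E) u, dot x u = 0 -> c 0 = x ->
          is_derive (0 : R) (1 : R) c u ->
          is_derive (0 : R) (1 : R) (fun s => H (c s) t) (dot x (cross (X x t) u)),
      forall x, unit x -> [/\ F x 0 = x, forall t, unit (F x t) &
        forall t, is_derive t (1 : R) (F x) (X (F x t) t)] &
      forall x t, unit x -> T <= t -> X x t = 0 /\ F x t = f x].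

Lemma ham_path_id : ham_path id 0.
Proof.
exists (fun _ _ => 0), (fun _ _ => 0), (fun x _ => x); split => //.
- move=> k; exact: Ck_cst.
- move=> x t xx; have d0 (y : E) : dot y 0 = 0 by rewrite -(scale0r 0) dotZr mul0r.
  have c0 (y : E) : cross 0 y = 0.
    by rewrite -[in LHS](scale0r (0 : E)) crossZl scale0r.
  by split => // c u *; rewrite c0 d0; exact: is_derive_cst.
- by move=> x xx; split => // t; exact: is_derive_cst.
Qed.

(** After time T + 1, when F already rests at f x, the flow of v is run up to
    time sg along the smooth step. Near every instant one of the two motions is
    at rest, namely the second one before T + 1 and the first one after T. *)
Lemma ham_path_flow f T v (sg : R) : ham_path f T ->
  ham_path (fun x => flow v sg (f x)) (T + 2).
Proof.
move=> [H [X [F [T0 CH XH FX end_]]]].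
pose r t : R := sg * dstep (t - (T + 1)).
pose a t : R := sg * step (t - (T + 1)).
have da t : is_derive t (1 : R) a (r t).
  have -> : a = sg *: (fun t => step (1 * t + - (T + 1))).
    by apply/funext => s; rewrite /a !fctE mul1r.
  have ds := is_derive_affine (is_derive_step (1 * t + - (T + 1))).
  have -> : r t = sg *: (1 * dstep (1 * t + - (T + 1))) by rewrite /r !mul1r.
  exact: is_deriveZ.
exists (fun x t => H x t + r t * ham v x), (fun x t => X x t + r t *: vfield v x),
  (fun x t => flow v (a t) (F x t)); split.
- lra.
- move=> k; apply: (CkD (f := fun p : E * R => H p.1 p.2)) => //.
  apply: (CkM (f := fun p : E * R => r p.2)); last exact: Ck_ham.
  apply: Ck_time => j.
  have -> : r = cst sg * (fun t => dstep (1 * t + - (T + 1))).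
    by apply/funext => s; rewrite /r !fctE mul1r.
  by apply: DkM; [exact: Dk_cst|apply/Dk_affine/Dk_dstep].
- move=> x t xx; have [xX dH] := XH x t xx; split.
    by rewrite dotDr dotZr vfield_tangent xX mulr0 addr0.
  move=> c u xu c0 dc; rewrite crossDl crossZl dotDr dotZr.
  have d1 := dH c u xu c0 dc.
  have d2 := ham_gradient e tLC v xx xu c0 dc.
  exact: (is_deriveD d1 (is_deriveZ (r t) d2)).
- move=> x xx; have [F0 FF dF] := FX x xx; split.
  + by rewrite F0 /a step_le0 ?mulr0 ?flow0 // sub0r oppr_le0 addr_ge0.
  + by move=> t; rewrite dot_flow.
  + move=> t; have [tT|Tt] := ltP t (T + 1).
      have r0 : r t = 0 by rewrite /r dstep_le0 ?mulr0 //; lra.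
      have a0 s : s < T + 1 -> a s = 0.
        by move=> sT; rewrite /a step_le0 ?mulr0 //; lra.
      rewrite r0 scale0r addr0 a0 // flow0.
      apply: (@near_eq_is_derive R R^o _ (F x)) => //.
      near=> s; rewrite a0 ?flow0 //.
      by near: s; exact: lt_nbhsl.
    have Tlt : T < t by lra.
    have Fc s : T < s -> F x s = f x by move=> Ts; case: (end_ x s xx (ltW Ts)).
    have [X0 _] := end_ _ t (etrans (dot_flow e eps LC v (a t) (F x t)) (FF t)) (ltW Tlt).
    rewrite X0 add0r.
    apply: (@near_eq_is_derive R R^o _ (fun s => flow v (a s) (f x))).
      near=> s; rewrite Fc //.
      by near: s; exact: lt_nbhsr.
    rewrite Fc //; apply: is_derive_flow => //.
    by rewrite -(Fc t).
- move=> x t xx Tt; have [|X0 F0] := end_ x t xx; first by lra.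
  rewrite X0 F0 add0r /r /a dstep_ge1 ?step_ge1 ?mulr1 ?mulr0 ?scale0r //; lra.
Unshelve. all: by end_near. Qed.

Lemma ham_path_act w : exists T, ham_path (act w) T.
Proof.
elim: w => [|[v b] w [T IH]]; first by exists 0; exact: ham_path_id.
by exists (T + 2); exact: ham_path_flow.
Qed.

Definition S2_of (x : E) (xx : unit x) : S2 R := exist _ x (mem_set xx).

Lemma S2_unit (x : S2 R) : unit (val x).
Proof. exact: (set_mem (valP x)). Qed.

Lemma ham_path_Ham f T (fu : forall x, unit x -> unit (f x)) : ham_path f T ->
  Ham (fun x : S2 R => S2_of (fu _ (S2_unit x))).
Proof.
move=> [H [X [F [T0 CH XH FX end_]]]].
have Fu (x : S2 R) t : unit (F (val x) t) by have [_ +] := FX _ (S2_unit x).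
exists (fun x t => H (val x) t), (fun x t => X (val x) t), (fun x t => S2_of (Fu x t)).
split.
- move=> x t; exists setT, (fun p => H p.1 p.2); split => //.
  by split => //; exact: openT.
- move=> x t; have [xX dH] := XH _ t (S2_unit x); split => // u xu c c0 dc.
  rewrite /area_form det_triple.
  by apply: (dH (fun s => val (c s))) => //; rewrite c0.
- split => x; first by apply/val_inj; have [] := FX _ (S2_unit x).
  by move=> t; have [_ _ dF] := FX _ (S2_unit x); exact: dF.
- exists T; apply/funext => x; apply/val_inj => /=.
  by have [_ ->] := end_ _ T (S2_unit x) (lexx T).
Qed.

End Concatenation.

(** * A polar cap *)

Section Cap.
Variable R : realType.
Local Notation E := 'rV[R]_3.
Local Notation unit x := (dot x x = 1).

Lemma dot2E (u v : 'rV[R]_2) : dot u v = u 0 0 * v 0 0 + u 0 1 * v 0 1.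
Proof.
rewrite /dot !big_ord_recr big_ord0 /= add0r.
by congr (_ + _); congr (u _ _ * v _ _); apply/val_inj.
Qed.

Definition S2_vec (x : S2 R) : E := val x.

(** The part of the closed northern hemisphere over the disk of radius d; a
    closed disk through its vertical projection. *)
Definition cap (d : R) : set (S2 R) := [set x | 0 <= S2_vec x 0 2%:R /\
  S2_vec x 0 0 ^+ 2 + S2_vec x 0 1 ^+ 2 <= d ^+ 2].

(** A subset carries the initial topology of the inclusion. *)
Lemma continuous_to_set_type (X Y : topologicalType) (A : set Y) (f : X -> set_type A) :
  continuous (fun x => val (f x)) -> continuous f.
Proof. by move=> cf; apply: continuous_comp_initial. Qed.

Lemma continuous_val (Y : topologicalType) (A : set Y) :
  continuous (val : set_type A -> Y).
Proof. exact: initial_continuous. Qed.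

Lemma continuous_row (X : topologicalType) n (f : X -> 'rV[R]_n) :
  (forall i, continuous (fun x => f x 0 i)) -> continuous f.
Proof.
move=> cf x A /nbhs_ballP[r r0 rA].
suff : \forall y \near x, ball (f x) r (f y) by apply: filterS => y; exact: rA.
near=> y; split => // i j; rewrite ord1; move: j; near: y.
apply: filter_forall => j; apply: (cf j x).
exact: nbhsx_ballx.
Unshelve. all: by end_near. Qed.

Lemma continuous_S2_vec i : continuous (fun x : S2 R => S2_vec x 0 i).
Proof.
move=> x; apply: (@continuous_comp _ _ _ S2_vec (fun y : E => y 0 i)).
  exact: continuous_val.
exact: coord_continuous.
Qed.

Lemma S2_vec_sqr (x : S2 R) :
  S2_vec x 0 0 ^+ 2 + S2_vec x 0 1 ^+ 2 + S2_vec x 0 2%:R ^+ 2 = 1.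
Proof. by have := S2_unit x; rewrite dot3E -!expr2. Qed.

Section CapDisk.
Variable d : R.
Hypotheses (d0 : 0 < d) (d1 : d <= 1).
Local Notation disk := (@unit_disk R).

Definition cap_pt (u : 'rV[R]_2) : E :=
  vec3 (d * u 0 0) (d * u 0 1) (Num.sqrt (1 - d ^+ 2 * dot u u)).

Lemma cap_pt_ge0 (u : 'rV[R]_2) : dot u u <= 1 -> 0 <= 1 - d ^+ 2 * dot u u.
Proof.
rewrite dot2E => u1; have u0 : 0 <= u 0 0 * u 0 0 + u 0 1 * u 0 1.
  by rewrite -!expr2 addr_ge0 // sqr_ge0.
have d2 : d ^+ 2 <= 1 by rewrite expr_le1 // ltW.
by rewrite subr_ge0; apply: mulr_ile1 => //; rewrite sqr_ge0.
Qed.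

Lemma unit_cap_pt (u : 'rV[R]_2) : dot u u <= 1 -> unit (cap_pt u).
Proof.
move=> u1; rewrite dot3E !vec3E -[Num.sqrt _ * _]expr2.
by rewrite sqr_sqrtr ?cap_pt_ge0 // dot2E; ring.
Qed.

Lemma diskP (u : set_type disk) : dot (val u) (val u) <= 1.
Proof. exact: (set_mem (valP u)). Qed.

Definition cap_S2 (u : set_type disk) : S2 R := S2_of (unit_cap_pt (diskP u)).

Lemma cap_S2_cap u : cap d (cap_S2 u).
Proof.
rewrite /cap /= /S2_vec /= !vec3E; split; first exact: sqrtr_ge0.
have := diskP u; rewrite dot2E => u1.
by rewrite !exprMn -mulrDr -[leRHS]mulr1 ler_wpM2l ?sqr_ge0.
Qed.

Definition cap_chart (u : set_type disk) : set_type (cap d) :=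
  exist _ (cap_S2 u) (mem_set (cap_S2_cap u)).

Definition proj_pt (x : S2 R) : 'rV[R]_2 := \row_i (S2_vec x 0 (lift ord_max i) / d).

Lemma proj_ptE (x : S2 R) :
  (proj_pt x 0 0 = S2_vec x 0 0 / d) * (proj_pt x 0 1 = S2_vec x 0 1 / d).
Proof. by rewrite /proj_pt !mxE; split; congr (S2_vec x 0 _ / d); apply/val_inj. Qed.

Lemma proj_disk (x : set_type (cap d)) : disk (proj_pt (val x)).
Proof.
have [_ xd] := set_mem (valP x).
rewrite /unit_disk /= dot2E !proj_ptE -!expr2 !exprMn exprVn -mulrDl.
by rewrite ler_pdivrMr ?exprn_gt0 // mul1r.
Qed.

Definition cap_inv (x : set_type (cap d)) : set_type disk :=
  exist _ (proj_pt (val x)) (mem_set (proj_disk x)).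

Lemma cap_closed_disk : closed_disk (cap d).
Proof.
exists cap_chart, cap_inv; split.
- apply: continuous_to_set_type; apply: continuous_to_set_type.
  have cu i : continuous (fun u : set_type disk => (val u : 'rV[R]_2) 0 i).
    move=> u; apply: (@continuous_comp (set_type disk) 'rV[R]_2 _ val
      (fun y : 'rV[R]_2 => y 0 i)).
      exact: continuous_val.
    exact: coord_continuous.
  have cd : continuous (fun u : set_type disk => dot (val u) (val u)).
    have -> : (fun u : set_type disk => dot (val u) (val u)) = (fun u =>
        (val u : 'rV[R]_2) 0 0 * (val u : 'rV[R]_2) 0 0 +
        (val u : 'rV[R]_2) 0 1 * (val u : 'rV[R]_2) 0 1).
      by apply/funext => u; rewrite dot2E.
    by move=> u; exact: (cvgD (cvgM (cu 0 u) (cu 0 u)) (cvgM (cu 1 u) (cu 1 u))).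
  apply: (@continuous_row (set_type disk) 3 (fun u => cap_pt (val u))) => -[[|[|[|//]]] hi].
  + have -> : (fun u : set_type disk => cap_pt (val u) 0 (Ordinal hi)) =
      (fun u : set_type disk => d * (val u : 'rV[R]_2) 0 0).
      by apply/funext => u; rewrite /= mxE.
    by move=> u; exact: (cvgM (cvg_cst _) (cu _ u)).
  + have -> : (fun u : set_type disk => cap_pt (val u) 0 (Ordinal hi)) =
      (fun u : set_type disk => d * (val u : 'rV[R]_2) 0 1).
      by apply/funext => u; rewrite /= mxE.
    by move=> u; exact: (cvgM (cvg_cst _) (cu _ u)).
  + have -> : (fun u : set_type disk => cap_pt (val u) 0 (Ordinal hi)) =
      (fun u : set_type disk => Num.sqrt (1 - d ^+ 2 * dot (val u) (val u))).
      by apply/funext => u; rewrite /= mxE.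
    move=> u; apply: (continuous_comp
      (f := fun u : set_type disk => 1 - d ^+ 2 * dot (val u) (val u)));
      last exact: sqrt_continuous.
    exact: (cvgB (cvg_cst _) (cvgM (cvg_cst _) (cd u))).
- apply: continuous_to_set_type.
  apply: (@continuous_row (set_type (cap d)) 2 (fun x => proj_pt (val x))) => i.
  have -> : (fun x : set_type (cap d) => proj_pt (val x) 0 i) =
     (fun x : set_type (cap d) => S2_vec (val x) 0 (lift ord_max i) / d).
    by apply/funext => x; rewrite /= mxE.
  have cv : continuous (fun x : set_type (cap d) => S2_vec (val x) 0 (lift ord_max i)).
    move=> x; apply: (@continuous_comp (set_type (cap d)) (S2 R) _ val
      (fun y : S2 R => S2_vec y 0 (lift ord_max i))); first exact: continuous_val.
    exact: continuous_S2_vec.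
  by move=> x; exact: (cvgM (cv x) (cvg_cst _)).
- move=> u; apply/val_inj => /=; apply/rowP => -[[|[|//]] hi].
  + rewrite (_ : Ordinal hi = 0); last exact/val_inj.
    by rewrite proj_ptE /S2_vec /= vec3E mulrAC divff ?mul1r // gt_eqF.
  + rewrite (_ : Ordinal hi = 1); last exact/val_inj.
    by rewrite proj_ptE /S2_vec /= vec3E mulrAC divff ?mul1r // gt_eqF.
- move=> x; apply/val_inj/val_inj => /=; have [x2 _] := set_mem (valP x).
  apply: rV3P; rewrite vec3E -/(S2_vec _) ?dot2E !proj_ptE.
  + by field; rewrite gt_eqF.
  + by field; rewrite gt_eqF.
  + rewrite -[RHS]ger0_norm // -sqrtr_sqr; congr Num.sqrt.
    have <- := S2_vec_sqr (val x).
    by field; rewrite gt_eqF.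
Qed.

Lemma unit_north : unit (north R).
Proof. exact: dot_north. Qed.

Lemma cap_interior : interior (cap d) !=set0.
Proof.
exists (S2_of unit_north); rewrite /interior.
pose x0 : S2 R := S2_of unit_north.
have c2 : S2_vec x 0 2%:R @[x --> x0] --> (1 : R).
  rewrite -[X in _ --> X](_ : S2_vec x0 0 2%:R = 1); last by rewrite /S2_vec /north vec3E.
  exact: continuous_S2_vec.
have c01 : S2_vec x 0 0 ^+ 2 + S2_vec x 0 1 ^+ 2 @[x --> x0] --> (0 : R).
  rewrite -[X in _ --> X](_ : S2_vec x0 0 0 ^+ 2 + S2_vec x0 0 1 ^+ 2 = 0); last first.
    by rewrite /S2_vec /north !vec3E expr0n addr0.
  exact: (cvgD (cvgM (@continuous_S2_vec 0 x0) (@continuous_S2_vec 0 x0))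
    (cvgM (@continuous_S2_vec 1 x0) (@continuous_S2_vec 1 x0))).
near=> x; split.
  by apply: ltW; near: x; exact: (cvgr_gt _ c2).
by apply: ltW; near: x; apply: (cvgr_lt _ c01); rewrite exprn_gt0.
Unshelve. all: by end_near. Qed.

End CapDisk.
End Cap.

(** * Faithfulness and the fixed disk *)

Section Faithful.
Variables (R : realType) (V : finType) (e : rel V).
Hypotheses (e_sym : symmetric e) (e_irr : irreflexive e).
Variables (L : seq (seq V)) (C : seq V -> circle R) (eps : R).
Hypotheses (LC : config L C) (tLC : thick L C eps).
Hypothesis HL : forall s : seq V, uniq s -> s \in L.
Local Notation E := 'rV[R]_3.
Local Notation unit x := (dot x x = 1).
Let eps0 : 0 < eps := thick_gt0 tLC.

(** The circle of c, travelled at constant speed, has points on both sides of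
    the annulus of c' and therefore crosses it. *)
Lemma circle_crosses (c c' : circle R) : unit (axis c) -> height c ^+ 2 < 1 ->
  sticks_out eps c c' -> exists g : R -> E,
    [/\ wcont g, forall r, unit (g r), forall r, ht c (g r) = height c &
        crosses eps c' c g].
Proof.
move=> nn h1 [f [f' [ff fn ff' fn' out]]].
pose rho := Num.sqrt (1 - height c ^+ 2).
have rho2 : rho ^+ 2 = 1 - height c ^+ 2 by rewrite sqr_sqrtr // subr_ge0 ltW.
pose m := cross (axis c) f.
have mn : dot m (axis c) = 0 by exact: dot_crossu.
have mf : dot m f = 0 by exact: dot_crossv.
have mm : dot m m = 1 by rewrite lagrange_identity nn ff (dotC _ f) fn; ring.
pose g r := height c *: axis c + (rho * cos r) *: f + (rho * sin r) *: m.
have cg : wcont g.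
  move=> u r; have -> : (fun r => dot (g r) u) = (fun r =>
     height c * dot (axis c) u + (rho * cos r) * dot f u + (rho * sin r) * dot m u).
    by apply/funext => s; rewrite /g !dotE.
  apply: cvgD; first apply: cvgD; first exact: cvg_cst.
    apply: cvgM; last exact: cvg_cst.
    by apply: cvgM; [exact: cvg_cst|exact: continuous_cos].
  apply: cvgM; last exact: cvg_cst.
  by apply: cvgM; [exact: cvg_cst|exact: continuous_sin].
have gh r : ht c (g r) = height c by rewrite /ht /g !dotE nn fn mn; ring.
have gg r : unit (g r).
  rewrite /g !dotE nn fn mn ff mf mm (dotC _ f) fn (dotC _ m) mn (dotC f m) mf.
  have := cos2Dsin2 r => cs.
  transitivity (height c ^+ 2 + rho ^+ 2 * (cos r ^+ 2 + sin r ^+ 2)); first by ring.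
  by rewrite cs rho2; ring.
have [|b [_ cb sb]] := @unit_angle R (dot f' f) (dot f' m).
  by have := frame_norm f' nn ff fn; rewrite ff' fn' -/m; lra.
have [|h0 hb] := out (height c); first by rewrite subrr normr0 ltW.
exists g; split => //.
have g0 : g 0 = meridian_pt c f (height c).
  by rewrite /g /meridian_pt cos0 sin0 mulr1 mulr0 scale0r addr0.
have gb : g b = meridian_pt c f' (height c).
  rewrite /g /meridian_pt cb sb -addrA -!scalerA -scalerDr -/rho.
  by rewrite [in RHS](frame_decomp f' nn ff fn) fn' scale0r add0r.
have [||s0 [s1 [lo0 hi1 sub]]] := @sub_crossing R (fun r => ht c' (g r)) b 0
  (lo eps c') (hi eps c') (cg (axis c')) (lo_lt_hi eps0 c').
- by rewrite gb; exact: ltW.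
- by rewrite g0; apply/ltW/(lt_trans _ h0); exact: hi_lt.
exists s0, s1; split => // s bs; split; first by case: (sub s bs).
by rewrite /band gh subrr normr0 ltW.
Qed.

(** Spell g by a word with the least number of syllables and let x be the label
    of one of them. The circle of the root crosses the annulus of [:: x] inside
    the annulus of the root; by ping-pong its image under g crosses the annulus
    of the root. If g acted trivially then the circle itself would do so, but
    its height over the root axis is constant. *)
Lemma phi_faithful (g : raag e) : (forall x, unit x -> phi L C eps g x = x) -> g = 1%g.
Proof.
move=> gid; have [[|[x k] s] sg min_s] := minimal_exists g; first by rewrite -sg.
have nL : [::] \in L by exact: HL.
have xL : [:: x] \in L by exact: HL.
have adj0 : adj [::] [:: x] by rewrite /adj /child_of /= eqxx.
have nn : unit (axis (C [::])) := axis_unit LC nL.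
have h1 : height (C [::]) ^+ 2 < 1.
  by apply: (thick_sq tLC nL); rewrite subrr normr0 ltW.
have [g0 [cg gg gh cr]] := circle_crosses nn h1 (thick_out tLC nL xL adj0).
have [|||r0 [r1 [h0 _ _]]] := pingpong e_sym e_irr LC tLC HL (ltnSn _) min_s
  (mem_head x _) _ _ _ cg gg cr => //.
have : ht (C [::]) (g0 r0) = lo eps (C [::]).
  by rewrite -[g0 r0](gid _ (gg r0)) -sg (phi_syl e_sym e_irr LC tLC).
by rewrite gh /lo => /esym/eqP; rewrite -subr_eq0 addrAC subrr add0r oppr_eq0 gt_eqF.
Qed.

(** The distance from a point of the cap to the north pole is at most sqrt(2)
    d, so the cap misses every annulus. *)
Lemma phi_fixes_cap (g : raag e) d (x : S2 R) : 0 < d -> 2 * d ^+ 2 <= eps ^+ 2 ->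
  cap d x -> phi L C eps g (S2_vec x) = S2_vec x.
Proof.
move=> d0 de [x2 xd]; have xx : unit (S2_vec x) := S2_unit x.
have le2 : 1 - d ^+ 2 <= S2_vec x 0 2%:R ^+ 2 by have := S2_vec_sqr x; lra.
have le1 : S2_vec x 0 2%:R <= 1.
  rewrite -(@expr_le1 _ 2) //; have := S2_vec_sqr x.
  by have := sqr_ge0 (S2_vec x 0 0); have := sqr_ge0 (S2_vec x 0 1); lra.
have le3 : S2_vec x 0 2%:R ^+ 2 <= S2_vec x 0 2%:R by rewrite expr2 ler_piMr.
have out s : s \in L -> ~~ band eps (C s) (S2_vec x).
  move=> sL; rewrite /band -ltNge.
  have := ht_close (axis_unit LC sL) xx (dot_north R).
  have -> : dot (S2_vec x) (north R) = S2_vec x 0 2%:R.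
    by rewrite dot3E /north !vec3E; ring.
  move=> close; have : (ht (C s) (S2_vec x) - ht (C s) (north R)) ^+ 2 <= eps ^+ 2.
    lra.
  rewrite -(real_normK (num_real (ht _ _ - _))) ler_pXn2r ?nnegrE ?(ltW eps0) //.
  have := ler_distD (ht (C s) (S2_vec x)) (ht (C s) (north R)) (height (C s)).
  have := thick_north tLC sL.
  by rewrite (distrC (ht _ (north R)) (ht _ (S2_vec x))); lra.
rewrite /phi; elim: (repr g) => //= p w ->.
by rewrite (flow_out tLC) // => s /nodes_L; exact: out.
Qed.

End Faithful.

Lemma uniq_seq_enum (V : finType) : exists M : seq (seq V), forall s, uniq s -> s \in M.
Proof.
exists [seq (bseqval b) | b <- enum {: {bseq #|V| of V}}] => s us.
have sV : (size s <= #|V|)%N by rewrite -(card_uniqP us) max_card.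
by apply/mapP; exists (Bseq sV); rewrite ?mem_enum.
Qed.

Theorem theorem1p1 (R : realType) (V : finType) (e : rel V)
    (e_sym : symmetric e) (e_irr : irreflexive e) :
  exists phi : raag e -> (S2 R -> S2 R),
    [/\ forall g, Ham (phi g),
        phi 1%g = id,
        forall g h, phi (g * h)%g = phi g \o phi h,
        injective phi &
        exists D : set (S2 R),
          [/\ closed_disk D, interior D !=set0 &
              forall g x, D x -> phi g x = x]].
Proof.
have [M HM] := uniq_seq_enum V.
have [L [C [LC ML]]] := config_exists R M.
have HL s : uniq s -> s \in L by move=> /HM/ML.
have [eps tLC] := thick_exists LC.
have eps0 := thick_gt0 tLC.
have fu (g : raag e) x : dot x x = 1 -> dot (phi L C eps g x) (phi L C eps g x) = 1.
  by rewrite (dot_phi _ LC).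
pose psi (g : raag e) (x : S2 R) : S2 R := S2_of (fu g _ (S2_unit x)).
have psi1 : psi 1%g = id.
  by apply/funext => x; apply/val_inj; apply: (phi1 e_sym e_irr LC tLC); exact: S2_unit.
have psiM g h : psi (g * h)%g = psi g \o psi h.
  by apply/funext => x; apply/val_inj; apply: (phiM e_sym e_irr LC tLC); exact: S2_unit.
exists psi; split => //.
- move=> g; have [T hT] := ham_path_act e_sym e_irr LC tLC (repr g).
  exact: (ham_path_Ham (fu g) hT).
- move=> g h gh; apply/eqP; rewrite -(inj_eq (mulgI h^-1)%g) mulVg; apply/eqP.
  apply: (phi_faithful e_sym e_irr LC tLC HL) => x xx.
  have := congr1 (fun f => val (f (S2_of xx))) psi1.
  by rewrite -(mulVg h) !psiM -gh -psiM.
- pose d := Num.min eps 1 / 2.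
  have d0 : 0 < d by rewrite divr_gt0 // lt_min eps0 ltr01.
  have [de d1] : d <= eps / 2 /\ d <= 1 / 2.
    by rewrite /d !ler_pM2r ?invr_gt0 // !ge_min !lexx orbT.
  exists (cap d); split.
  + by apply: cap_closed_disk => //; lra.
  + exact: cap_interior.
  + move=> g x xd; apply/val_inj.
    have de2 : 2 * d ^+ 2 <= eps ^+ 2.
      have : d ^+ 2 <= (eps / 2) ^+ 2 by rewrite ler_pXn2r // nnegrE ?(ltW d0) // divr_ge0 // ltW.
      by have := sqr_ge0 eps; lra.
    exact: (phi_fixes_cap LC tLC g d0 de2 xd).
Qed.
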